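(* Let $m,n>1$ be integers. The following statements hold, where numbers of invariant meridian hyperplanes are counted taking into account multiplicities. (1) There are vector fields of degree $m$ on $\mathbb{S}^n$ with at least $\binom{n-1}{2}(m-2)+(n-1)(m-1)$ invariant meridian hyperplanes. (2) There are vector fields of degree $m$ on $\mathbb{S}^n$ with at least $m-1$ invariant meridian hyperplanes each with multiplicity $n-1$. (3) A degree $m$ vector field on $\mathbb{S}^2$ having finitely many invariant meridian hyperplanes can have at most $m$ invariant meridian hyperplanes. Moreover, this bound can be reached. (4) There are vector fields of degree $m$ on $\mathbb{S}^3$ with $3m-2$ invariant meridian hyperplanes.
   Context: $\mathbb{S}^n=\{x\in\mathbb{R}^{n+1} : \sum_i x_i^2=1\}$; $\binom{1}{2}=0$. A polynomial vector field $\chi=(P_1,\ldots,P_{n+1})$ in $\mathbb{R}^{n+1}$ is identified with the operator $\sum_i P_i\,\partial/\partial x_i$; its degree is $\max_i\deg P_i$. It is a vector field on $\mathbb{S}^n$ if $\chi(\sum_i x_i^2-1)=K(\sum_i x_i^2-1)$ for some real polynomial $K$. The zero set $\{f=0\}$ of a polynomial $f\in\mathbb{R}[x_1,\ldots,x_{n+1}]$ is an invariant algebraic set of $\chi$ if $\chi f=Kf$ for some $K\in\mathbb{R}[x_1,\ldots,x_{n+1}]$. A meridian hyperplane is a hyperplane $\{\sum_{i=1}^{n}a_ix_i=0\}$ in $\mathbb{R}^{n+1}$ with $a_i\in\mathbb{R}$, $\sum_{i=1}^{n} a_i^2=1$ (so $x_{n+1}$ does not occur and the hyperplane passes through the origin).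 Multiplicity: for a finite-dimensional subspace $W\subset\mathbb{R}[x_1,\ldots,x_{n+1}]$ with basis $v_1,\ldots,v_k$, the extactic polynomial is $\mathcal{E}_W(\chi)=\det\big(\chi^{i-1}(v_j)\big)_{1\le i,j\le k}$, where $\chi^0(v)=v$ and $\chi^{i}(v)=\chi^{i-1}(\chi(v))$. An algebraic set $\{f=0\}$ with $f\in W$ has multiplicity $\mu$ for $\chi$ if $\mathcal{E}_W(\chi)\neq0$, $f^{\mu}$ divides $\mathcal{E}_W(\chi)$, and $f^{\mu'}$ does not divide $\mathcal{E}_W(\chi)$ for any $\mu'>\mu$. For meridian hyperplanes one takes $W=\langle x_1,\ldots,x_n\rangle$. *)

(* Defs.v *)
From HB Require Import structures.
From mathcomp Require Import all_boot all_order all_algebra.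
From mathcomp Require Import boolp classical_sets cardinality reals.
From mathcomp Require Import mpoly.

Set Implicit Arguments.
Unset Strict Implicit.
Unset Printing Implicit Defensive.

Import Order.TTheory GRing.Theory Num.Theory.

Local Open Scope classical_set_scope.
Local Open Scope ring_scope.

Definition vfield (R : realType) (N : nat) : Type := 'I_N -> {mpoly R[N]}.

Section VectorFields.
Variables (R : realType) (N : nat).
Implicit Types (chi : vfield R N) (f g : {mpoly R[N]}).

Definition vf_op chi f : {mpoly R[N]} := \sum_(i < N) chi i * f^`M(i).

(* [msize p] is 1 + deg p, and 0 for p = 0. *)
Definition vf_degree chi : nat := \max_(i < N) (msize (chi i)).-1.

Definition invariant chi f : Prop := exists K : {mpoly R[N]}, vf_op chi f = K * f.

Definition zero_set f : set ('I_N -> R) := [set x | f.@[x] = 0].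

Definition mpdivides f g : Prop := exists q : {mpoly R[N]}, g = q * f.

Definition in_span k (v : 'I_k -> {mpoly R[N]}) f : Prop :=
  exists c : 'I_k -> R, f = \sum_(j < k) c j *: v j.

(* [v] is meant to be a basis of W; changing the basis multiplies the extactic
   polynomial by a nonzero constant. *)
Definition extactic k (v : 'I_k -> {mpoly R[N]}) chi : {mpoly R[N]} :=
  \det (\matrix_(i < k, j < k) iter i (vf_op chi) (v j)).

Definition has_multiplicity k (v : 'I_k -> {mpoly R[N]}) chi f (mu : nat) : Prop :=
  [/\ in_span v f,
      extactic v chi != 0,
      mpdivides (f ^+ mu) (extactic v chi)
    & forall mu' : nat, (mu < mu')%N -> ~ mpdivides (f ^+ mu') (extactic v chi)].

End VectorFields.

Section Sphere.
Variables (R : realType) (n : nat).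
Implicit Types (chi : vfield R n.+1) (a : 'I_n -> R).

Definition sphere_poly : {mpoly R[n.+1]} := (\sum_(i < n.+1) 'X_i ^+ 2) - 1.

Definition on_sphere chi : Prop := invariant chi sphere_poly.

(* The first n of the n + 1 coordinates, i.e. x_1, ..., x_n. *)
Definition meridian_basis (j : 'I_n) : {mpoly R[n.+1]} :=
  'X_(widen_ord (leqnSn n) j).

Definition meridian a : {mpoly R[n.+1]} := \sum_(j < n) a j *: meridian_basis j.

Definition unit_normal a : Prop := \sum_(j < n) a j ^+ 2 = 1.

(* As subsets of R^(n+1), so that the normals a and - a are not told apart. *)
Definition invariant_meridians chi : set (set ('I_n.+1 -> R)) :=
  [set H | exists a, [/\ unit_normal a, invariant chi (meridian a)
                       & H = zero_set (meridian a)]].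

Definition meridian_family chi k (a : 'I_k -> 'I_n -> R) (mu : 'I_k -> nat) : Prop :=
  injective (fun i => zero_set (meridian (a i))) /\
  forall i, [/\ unit_normal (a i), invariant chi (meridian (a i))
              & has_multiplicity meridian_basis chi (meridian (a i)) (mu i)].

Definition at_least_meridians chi (d : nat) : Prop :=
  exists k (a : 'I_k -> 'I_n -> R) (mu : 'I_k -> nat),
    meridian_family chi a mu /\ (d <= \sum_(i < k) mu i)%N.

(* The total count, with multiplicities, is d: the family exhausts all the
   invariant meridian hyperplanes. *)
Definition num_meridians chi (d : nat) : Prop :=
  exists k (a : 'I_k -> 'I_n -> R) (mu : 'I_k -> nat),
    [/\ meridian_family chi a mu,
        invariant_meridians chi = range (fun i => zero_set (meridian (a i)))
      & d = \sum_(i < k) mu i]%N.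

End Sphere.

(* Main.v *)
Require Import Defs.
From mathcomp Require Import all_boot all_order all_algebra.
From mathcomp Require Import boolp classical_sets cardinality reals.
From mathcomp Require Import mpoly complex.
From mathcomp Require Import ring zify lra.

(** Write l_a for the linear form of the meridian hyperplane with unit normal a,
    and E for the extactic polynomial of x_1, ..., x_n.

    If l_a is invariant then every chi^i(l_a) is a multiple of l_a, so modulo
    l_a a linear combination of the columns of the extactic matrix vanishes and
    l_a divides E ([invariant_dvd_extactic]).  Moreover l_a is a prime element:
    the substitution [hyperproj a], orthogonal projection onto the hyperplane,
    is a ring endomorphism which is the identity modulo l_a and kills l_a, so
    that l_a divides f exactly when the substitution kills f.  Counting invariant
    meridian hyperplanes thus becomes reading off the factors l_a of E, and the
    exact multiplicity can be certified at one point of the hyperplane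
    ([has_multiplicityI]).

    The four examples are computed with one reduction ([extactic_echelon]).  Row
    i of the extactic matrix is chi^i applied to the basis.  If a sequence of
    rows w_0, w_1, ... starts with the basis and satisfies
    e chi(w_k) = g w_(k+1) + h_k w_k, then e^k chi^k is a triangular combination
    of w_0, ..., w_k with leading coefficient g^k, and
    e^C(n,2) E = g^C(n,2) det(w).  In the examples w is triangular or tiny.

    Three examples have the form P_j = z Q_j for j <= n, where z = x_(n+1), with
    last component - sum_j x_j Q_j: such fields are tangent to the sphere.

    - Diagonal field, Q_j = (j - 1) x_1^(m-2) x_j: the rows are falling
      factorials and E = c (z x_1^(m-2))^C(n,2) x_1 ... x_n.  It has exactly
      n + (m-2) C(n,2) hyperplanes with multiplicities; this count is at least
      the one required for general n, and for n = 2 it is m.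
    - Chain field (m = 2), a nilpotent Jordan block of size n - 1 plus an
      eigenvalue 1: E = z^C(n,2) x_1^(n-1) x_n.
    - Pencil field (m > 2).  Take a binary form f(s, u) of degree m - 1 with
      distinct real roots, let u' = 0, s' = f and give x_j the rate
      (j - 1) f_s, up to the factor z.  Along a trajectory with u = 1 the
      coordinates are constants times 1, f, f^2, ..., f^(n-2), together with s.
      Differentiating with respect to f instead of time makes the matrix
      triangular, with last entry the (n-1)-st derivative of the inverse
      function s(f), and f^(n-1) is what remains in E.  So every factor of f has
      multiplicity n - 1 as soon as that derivative does not vanish at the roots
      of f.  Up to a power of f_s it is a polynomial in s that depends only on
      f_s, and it is not zero when deg f > 1; hence replacing f by f - c for a
      generic small constant c makes it nonzero at all the roots
      ([even_roots_poly_generic]).  Chain and pencil fields together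
      provide the m - 1 hyperplanes of multiplicity n - 1.

    The fourth example, on S^3, is x_1^(m-1) times the rotation of the
    (x_2, x_3)-plane, for which E = x_1^(3m-2) (x_2^2 + x_3^2).

    For the upper bound on S^2, E = x_1 P_2 - x_2 P_1 has degree at most m + 1.  It is
    not zero, since otherwise chi acts on the linear forms in x_1, x_2 as a
    multiplication and all the meridian hyperplanes are invariant.  If the
    multiplicities add up to more than m, then E is a constant times a product
    of m + 1 real linear forms in x_1, x_2, hence a nonzero multiple of t^(m+1)
    on the complex isotropic line (t, i t, 0).  But x_1^2 + x_2^2 vanishes on
    this line, so tangency to the sphere, with cofactor K, gives 2 E = i K
    there, and K has degree at most m - 1. *)

Set Implicit Arguments.
Unset Strict Implicit.
Unset Printing Implicit Defensive.

Import Order.TTheory GRing.Theory Num.Theory.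

Local Open Scope classical_set_scope.
Local Open Scope ring_scope.

(** * Derivations and triangular determinants *)

Section Derivation.
Variables (R : realType) (N : nat).
Implicit Types (chi : vfield R N) (f g : {mpoly R[N]}).

Lemma vf_opD chi : {morph vf_op chi : f g / f + g}.
Proof.
by move=> f g; rewrite /vf_op -big_split; apply: eq_bigr => i _; rewrite mderivD mulrDr.
Qed.

Lemma vf_op0 chi : vf_op chi 0 = 0.
Proof. by rewrite /vf_op big1 // => i _; rewrite mderiv0 mulr0. Qed.

Lemma vf_op_sum chi (I : Type) (r : seq I) (P : pred I) (F : I -> {mpoly R[N]}) :
  vf_op chi (\sum_(i <- r | P i) F i) = \sum_(i <- r | P i) vf_op chi (F i).
Proof. exact: (big_morph _ (vf_opD chi) (vf_op0 chi)). Qed.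

Lemma vf_opZ chi c f : vf_op chi (c *: f) = c *: vf_op chi f.
Proof.
by rewrite /vf_op scaler_sumr; apply: eq_bigr => i _; rewrite mderivZ scalerAr.
Qed.

Lemma vf_opC chi c : vf_op chi c%:MP = 0.
Proof. by rewrite /vf_op big1 // => i _; rewrite mderivC mulr0. Qed.

Lemma vf_op1 chi : vf_op chi 1 = 0.
Proof. by rewrite -mpolyC1 vf_opC. Qed.

Lemma vf_opM chi f g : vf_op chi (f * g) = vf_op chi f * g + f * vf_op chi g.
Proof.
rewrite /vf_op mulr_suml mulr_sumr -big_split; apply: eq_bigr => i _ /=.
by rewrite mderivM; ring.
Qed.

Lemma vf_opN chi f : vf_op chi (- f) = - vf_op chi f.
Proof. by rewrite -scaleN1r vf_opZ scaleN1r. Qed.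

Lemma vf_opX chi i : vf_op chi 'X_i = chi i.
Proof.
rewrite /vf_op (bigD1 i) //= big1 => [|j ji]; rewrite mderivX mnmE.
  by rewrite eqxx scale1r addr0 -{1}[U_(i)%MM]add0m addmK mpolyX0 mulr1.
by rewrite eq_sym (negPf ji) scale0r mulr0.
Qed.

Lemma vf_opXn chi f k : vf_op chi (f ^+ k.+1) = (vf_op chi f * f ^+ k) *+ k.+1.
Proof.
elim: k => [|k IH]; first by rewrite !expr1 mulr1.
rewrite exprS vf_opM IH exprS !mulrS -!mulrnAr; ring.
Qed.

End Derivation.

Lemma det_triu (R : comPzRingType) n (A : 'M[R]_n) :
  (forall i j : 'I_n, (j < i)%N -> A i j = 0) -> \det A = \prod_i A i i.
Proof.
move=> A0; rewrite -det_tr det_trig; last first.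
  by apply/is_trig_mxP => i j ij; rewrite mxE A0.
by apply: eq_bigr => i _; rewrite mxE.
Qed.

Lemma det2E (R : comPzRingType) (A : 'M[R]_2) :
  \det A = A ord0 ord0 * A ord_max ord_max - A ord0 ord_max * A ord_max ord0.
Proof.
have l0 : lift ord0 ord0 = ord_max :> 'I_2 by apply/val_inj.
have l1 : lift ord_max ord0 = ord0 :> 'I_2 by apply/val_inj.
rewrite (expand_det_row _ ord0) !big_ord_recl big_ord0 /cofactor !det_mx11 !mxE /=.
rewrite l0 l1 addn0 expr0 expr1; ring.
Qed.

(** * Reduction of the extactic matrix *)

Section Extactic.
Variables (R : realType) (N n : nat).
Implicit Types (chi : vfield R N) (v : 'I_n -> {mpoly R[N]}).

(** Coefficient of the row w_l in e^k chi^k(w_0), when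
    e chi(w_k) = g w_(k+1) + h_k w_k for all k.  The term with [vf_op chi e]
    undoes the derivative of the factor e^k. *)
Fixpoint echelon chi (e g : {mpoly R[N]}) (h : nat -> {mpoly R[N]}) (k l : nat) :
    {mpoly R[N]} :=
  if k is k'.+1 then
    e * vf_op chi (echelon chi e g h k' l)
    + (h l - vf_op chi e *+ k') * echelon chi e g h k' l
    + (if l is l'.+1 then g * echelon chi e g h k' l' else 0)
  else (l == 0)%:R.

Lemma echelon_gt chi e g h k l : (k < l)%N -> echelon chi e g h k l = 0.
Proof.
elim: k l => [|k IH] [|l] //= kl.
by rewrite !IH ?vf_op0 ?(ltnW kl) //; ring.
Qed.

Lemma echelon_diag chi e g h k : echelon chi e g h k k = g ^+ k.
Proof. by elim: k => [|k IH] //=; rewrite echelon_gt // vf_op0 IH exprS; ring. Qed.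

Lemma iter_echelon chi v (e g : {mpoly R[N]}) h (w : nat -> 'I_n -> {mpoly R[N]}) :
    (forall j, w 0 j = v j) ->
    (forall k j, e * vf_op chi (w k j) = g * w k.+1 j + h k * w k j) ->
  forall k p j, (k < p)%N ->
  e ^+ k * iter k (vf_op chi) (v j)
  = \sum_(l < p) echelon chi e g h k l * w l j.
Proof.
move=> w0 wS; elim=> [|k IH] [//|p] j kp.
  rewrite big_ord_recl big1 => [|i _] /=; last by rewrite mul0r.
  by rewrite expr0 !mul1r addr0 w0.
have step : e ^+ k.+1 * iter k.+1 (vf_op chi) (v j) =
  e * vf_op chi (e ^+ k * iter k (vf_op chi) (v j))
  - (vf_op chi e *+ k) * (e ^+ k * iter k (vf_op chi) (v j)).
  case: k {IH kp} => [|k]; first by rewrite expr0 !mul1r mulr0n mul0r subr0 expr1.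
  rewrite [in RHS]vf_opM vf_opXn [iter k.+2 _ _]/= -mulrnAl !exprS; ring.
rewrite {}step (IH p.+1 j (ltnW kp)) vf_op_sum !mulr_sumr -sumrB.
under eq_bigr => l _.
  rewrite vf_opM (_ : _ - _ = (e * vf_op chi (echelon chi e g h k l)
    + (h l - vf_op chi e *+ k) * echelon chi e g h k l) * w l j
    + echelon chi e g h k l * (g * w l.+1 j)).
  over.
  rewrite -[g * _](addrK (h l * w l j)) -wS; ring.
rewrite big_split /= [X in _ + X = _]big_ord_recr /= (echelon_gt _ _ _ _ (ltnSE kp)) mul0r addr0.
under [RHS]eq_bigr do rewrite mulrDl.
rewrite big_split /=; congr (_ + _); rewrite [RHS]big_ord_recl mul0r add0r.
by apply: eq_bigr => i _; rewrite /bump /=; ring.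
Qed.

(** Replaces the iterates of chi, which are rarely explicit, by rows that are
    explicit.  The powers of e and g come from the two triangular factors,
    since 0 + 1 + ... + (n - 1) = C(n, 2). *)
Lemma extactic_echelon chi v (e g : {mpoly R[N]}) h (w : nat -> 'I_n -> {mpoly R[N]}) :
    (forall j, w 0 j = v j) ->
    (forall k j, e * vf_op chi (w k j) = g * w k.+1 j + h k * w k j) ->
  e ^+ 'C(n, 2) * extactic v chi
  = g ^+ 'C(n, 2) * \det (\matrix_(k < n, j < n) w k j).
Proof.
move=> w0 wS.
have sumC (x : {mpoly R[N]}) : \prod_(k < n) x ^+ k = x ^+ 'C(n, 2).
  by rewrite -expr_sum -(big_mkord xpredT id) bin2_sum.
pose L := \matrix_(k < n, l < n) echelon chi e g h k l.
have -> : g ^+ 'C(n, 2) = \det L.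
  rewrite det_trig => [|]; last first.
    by apply/is_trig_mxP => i j ij; rewrite mxE echelon_gt.
  by rewrite -sumC; apply: eq_bigr => i _; rewrite mxE echelon_diag.
rewrite -det_mulmx /extactic -sumC.
pose D := diag_mx (\row_(k < n) e ^+ k).
have -> : \prod_(k < n) e ^+ k = \det D.
  by rewrite det_diag; apply: eq_bigr => i _; rewrite mxE.
rewrite -det_mulmx; congr (\det _); apply/matrixP => i j.
rewrite mul_diag_mx !mxE (iter_echelon w0 wS j (ltn_ord i)).
by apply: eq_bigr => l _; rewrite !mxE.
Qed.

(** Invariance of f says that chi preserves the ideal generated by f. *)
Lemma invariant_iter chi f k : Defs.invariant chi f -> mpdivides f (iter k (vf_op chi) f).
Proof.
move=> [K fK]; elim: k => [|k [q /= ->]]; first by exists 1; rewrite mul1r.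
by exists (vf_op chi q + q * K); rewrite vf_opM fK; ring.
Qed.

Lemma iter_vf_op_sum chi v (c : 'I_n -> R) k :
  iter k (vf_op chi) (\sum_j c j *: v j) = \sum_j c j *: iter k (vf_op chi) (v j).
Proof.
elim: k => [//|k /= ->]; rewrite vf_op_sum; apply: eq_bigr => j _.
by rewrite vf_opZ.
Qed.

End Extactic.

(** * Meridian forms are prime *)

Section MeridianForms.
Variables (R : realType) (n : nat).
Implicit Types (a b : 'I_n -> R) (f g : {mpoly R[n.+1]}) (chi : vfield R n.+1).

Lemma mpdividesD d f g : mpdivides d f -> mpdivides d g -> mpdivides d (f + g).
Proof. by move=> [p ->] [q ->]; exists (p + q); rewrite mulrDl. Qed.

Lemma mpdividesMl d f g : mpdivides d g -> mpdivides d (f * g).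
Proof. by move=> [q ->]; exists (f * q); rewrite mulrA. Qed.

Lemma mpdivides_eval d f (p : 'I_n.+1 -> R) :
  mpdivides d f -> d.@[p] = 0 -> f.@[p] = 0.
Proof. by move=> [q ->] dp; rewrite mevalM dp mulr0. Qed.

Lemma mpdivides_exp_le d f k l : (k <= l)%N -> mpdivides (d ^+ l) f -> mpdivides (d ^+ k) f.
Proof.
move=> kl [q ->]; exists (q * d ^+ (l - k)).
by rewrite -mulrA -exprD subnK.
Qed.

Definition ambient a (i : 'I_n.+1) : R := oapp a 0 (unlift ord_max i).

Lemma widen_lift (j : 'I_n) : widen_ord (leqnSn n) j = lift ord_max j.
Proof. by apply/val_inj; rewrite /= /bump leqNgt ltn_ord. Qed.

Lemma ambientE a j : ambient a (widen_ord (leqnSn n) j) = a j.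
Proof. by rewrite /ambient widen_lift liftK. Qed.

Lemma ambient_max a : ambient a ord_max = 0.
Proof. by rewrite /ambient unlift_none. Qed.

Lemma unit_normal_neq0 a : unit_normal a -> exists j, a j != 0.
Proof.
move=> ua; apply: contrapT => a0; move: ua; rewrite /unit_normal big1.
  by move/esym/eqP; rewrite oner_eq0.
move=> j _; case: (eqVneq (a j) 0) => [->|aj]; first by rewrite expr0n.
by case: a0; exists j.
Qed.

Lemma meval_meridian a (p : 'I_n.+1 -> R) :
  (meridian a).@[p] = \sum_j a j * p (widen_ord (leqnSn n) j).
Proof.
rewrite /meridian raddf_sum; apply: eq_bigr => j _ /=.
by rewrite mevalZ mevalXU.
Qed.

Lemma vf_op_meridian chi a :
  vf_op chi (meridian a) = \sum_j a j *: chi (widen_ord (leqnSn n) j).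
Proof. by rewrite vf_op_sum; apply: eq_bigr => j _; rewrite vf_opZ vf_opX. Qed.

(** Orthogonal projection onto the hyperplane with unit normal a, acting on
    polynomials; it is the quotient map by the ideal of [meridian a], realised
    inside the polynomial ring. *)
Definition hyperproj a f : {mpoly R[n.+1]} :=
  mmap (@mpolyC n.+1 R) (fun i => 'X_i - ambient a i *: meridian a) f.

Lemma hyperprojX a i : hyperproj a 'X_i = 'X_i - ambient a i *: meridian a.
Proof. by rewrite /hyperproj mmapX mmap1U. Qed.

Lemma hyperprojD a : {morph hyperproj a : f g / f + g}.
Proof. exact: mmapD. Qed.

Lemma hyperprojM a : {morph hyperproj a : f g / f * g}.
Proof. by move=> f g; rewrite /hyperproj rmorphM. Qed.

Lemma hyperprojZ a c f : hyperproj a (c *: f) = c *: hyperproj a f.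
Proof. by rewrite /hyperproj mmapZ mul_mpolyC. Qed.

Lemma hyperproj0 a : hyperproj a 0 = 0. Proof. exact: mmap0. Qed.

Lemma hyperproj_sum a (I : Type) (r : seq I) (P : pred I) (F : I -> {mpoly R[n.+1]}) :
  hyperproj a (\sum_(i <- r | P i) F i) = \sum_(i <- r | P i) hyperproj a (F i).
Proof. exact: (big_morph _ (hyperprojD a) (hyperproj0 a)). Qed.

Lemma hyperproj_meridian a b :
  hyperproj a (meridian b) = meridian b - (\sum_j b j * a j) *: meridian a.
Proof.
rewrite {1 2}/meridian hyperproj_sum scaler_suml -sumrB; apply: eq_bigr => j _.
by rewrite hyperprojZ hyperprojX ambientE scalerBr scalerA.
Qed.

(** Both the identity and [hyperproj a] are ring morphisms, so it suffices that
    they agree on the variables modulo the form. *)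
Lemma hyperproj_congr a f : mpdivides (meridian a) (f - hyperproj a f).
Proof.
have congrM f1 f2 : mpdivides (meridian a) (f1 - hyperproj a f1) ->
    mpdivides (meridian a) (f2 - hyperproj a f2) ->
    mpdivides (meridian a) (f1 * f2 - hyperproj a (f1 * f2)).
  move=> d1 d2; rewrite hyperprojM.
  have -> : f1 * f2 - hyperproj a f1 * hyperproj a f2 =
     f2 * (f1 - hyperproj a f1) + hyperproj a f1 * (f2 - hyperproj a f2) by ring.
  by apply: mpdividesD; apply: mpdividesMl.
have congr1 : mpdivides (meridian a) (1 - hyperproj a 1).
  by exists 0; rewrite mul0r /hyperproj rmorph1 subrr.
elim/mpolyind: f => [|c m p _ _ IH].
  by exists 0; rewrite hyperproj0 mul0r subrr.
rewrite hyperprojD hyperprojZ opprD addrACA -scalerBr.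
apply: mpdividesD => //; rewrite -mul_mpolyC; apply: mpdividesMl.
rewrite mpolyXE_id.
apply: (big_ind (fun x => mpdivides _ (x - hyperproj a x)) congr1 congrM) => i _.
elim: (m i) => [|k IHk]; first exact: congr1.
rewrite exprS; apply: congrM IHk.
exists (ambient a i)%:MP; rewrite hyperprojX mul_mpolyC; ring.
Qed.

Section UnitNormal.
Variables (a : 'I_n -> R) (ua : unit_normal a).

Lemma hyperproj_self : hyperproj a (meridian a) = 0.
Proof.
rewrite hyperproj_meridian (eq_bigr (fun j => a j ^+ 2)) => [|j _]; last by rewrite expr2.
by rewrite ua scale1r subrr.
Qed.

(** Divisibility by a meridian form is the vanishing of a ring morphism with
    values in a domain; this is why the form is prime. *)
Lemma meridian_dvdP f : mpdivides (meridian a) f <-> hyperproj a f = 0.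
Proof.
split=> [[q ->]|f0]; first by rewrite hyperprojM hyperproj_self mulr0.
by rewrite -[f]subr0 -f0; apply: hyperproj_congr.
Qed.

Lemma meridian_dvdM f g : mpdivides (meridian a) (f * g) ->
  mpdivides (meridian a) f \/ mpdivides (meridian a) g.
Proof.
rewrite !meridian_dvdP hyperprojM => /eqP.
by rewrite mulf_eq0 => /orP[] /eqP; [left|right].
Qed.

Lemma meridian_dvdX f k : mpdivides (meridian a) (f ^+ k) -> mpdivides (meridian a) f.
Proof.
elim: k => [|k IH]; last by rewrite exprS => /meridian_dvdM[].
rewrite expr0 meridian_dvdP /hyperproj rmorph1 => /eqP.
by rewrite oner_eq0.
Qed.

Lemma meridian_dvd_prod (I : eqType) (r : seq I) (F : I -> {mpoly R[n.+1]}) :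
  mpdivides (meridian a) (\prod_(i <- r) F i) ->
  exists2 i, i \in r & mpdivides (meridian a) (F i).
Proof.
elim: r => [|i r IH]; rewrite ?big_nil ?big_cons.
  by rewrite -[1](expr0 1) => /meridian_dvdX; rewrite meridian_dvdP /hyperproj rmorph1
    => /eqP; rewrite oner_eq0.
case/meridian_dvdM => [di|/IH[j jr dj]]; first by exists i; rewrite ?mem_head.
by exists j; rewrite ?inE ?jr ?orbT.
Qed.

Lemma mcoeff_meridian b j : (meridian b)@_U_(widen_ord (leqnSn n) j) = b j.
Proof.
rewrite /meridian raddf_sum (bigD1 j) //= big1 => [|i ij].
  by rewrite mcoeffZ mcoeffXU eqxx mulr1 addr0.
rewrite mcoeffZ mcoeffXU -(inj_eq val_inj) /= (inj_eq val_inj) (negPf ij).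
by rewrite mulr0.
Qed.

Lemma meridian_neq0 : meridian a != 0.
Proof.
have [j aj] := unit_normal_neq0 ua; apply: contra aj => /eqP l0.
by rewrite -mcoeff_meridian l0 mcoeff0.
Qed.

Lemma msize_meridian : msize (meridian a) = 2%N.
Proof.
apply/eqP; rewrite eqn_leq; apply/andP; split.
  apply: leq_trans (msize_sum _ _ _) _; apply/bigmax_leqP => j _.
  by apply: leq_trans (msizeZ_le _ _) _; rewrite msizeX mdeg1.
rewrite ltnNge; apply/negP => /msize1_polyC lC.
have [j] := unit_normal_neq0 ua; rewrite -(mcoeff_meridian a) lC mcoeffC.
by rewrite mnm1_eq0 mulr0 eqxx.
Qed.

Lemma msize_meridianX k : msize (meridian a ^+ k) = k.+1.
Proof.
elim: k => [|k IH]; first by rewrite expr0 msize1.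
by rewrite exprS msizeM ?expf_neq0 ?meridian_neq0 // msize_meridian IH.
Qed.

Lemma meridian_dvd_cancel k f g : ~ mpdivides (meridian a) g ->
  mpdivides (meridian a ^+ k) (f * g) -> mpdivides (meridian a ^+ k) f.
Proof.
move=> ng; elim: k f => [|k IH] f; first by exists f; rewrite expr0 mulr1.
move=> dfg; have [|[f1 ef]|//] := @meridian_dvdM f g.
  by move: (mpdivides_exp_le (isT : (1 <= k.+1)%N) dfg); rewrite expr1.
have /IH[q f1E] : mpdivides (meridian a ^+ k) (f1 * g).
  have [q fgq] := dfg; exists q; apply: (mulIf meridian_neq0).
  by rewrite -[RHS]mulrA -exprSr -fgq ef; ring.
by exists q; rewrite ef f1E exprSr mulrA.
Qed.

(** The projection of the normal b onto the hyperplane orthogonal to a vanishes,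
    so b is proportional to a. *)
Lemma meridian_dvd_eqset b : unit_normal b -> mpdivides (meridian a) (meridian b) ->
  zero_set (meridian b) = zero_set (meridian a).
Proof.
move=> ub; rewrite meridian_dvdP hyperproj_meridian => /eqP; rewrite subr_eq0 => /eqP lb.
set c := \sum_j _ in lb.
have c0 : c != 0.
  have [j bj] := unit_normal_neq0 ub; apply: contra bj => /eqP c0.
  by rewrite -mcoeff_meridian lb c0 scale0r mcoeff0.
apply/seteqP; split=> p; rewrite /zero_set /= lb mevalZ => /eqP.
  by rewrite mulf_eq0 (negPf c0) => /eqP.
by move=> /eqP ->; rewrite mulr0.
Qed.

(** Modulo the form, the extactic matrix kills the vector a: its i-th entry is
    then chi^i of the form.  A square matrix over a domain with a nonzero kernel
    vector has determinant 0. *)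
Lemma invariant_dvd_extactic chi : Defs.invariant chi (meridian a) ->
  mpdivides (meridian a) (extactic (@meridian_basis R n) chi).
Proof.
move=> inv; rewrite meridian_dvdP.
pose M := \matrix_(i < n, j < n) hyperproj a (iter i (vf_op chi) (meridian_basis R j)).
have -> : hyperproj a (extactic (@meridian_basis R n) chi) = \det M.
  rewrite /extactic /hyperproj -det_map_mx; congr (\det _).
  by apply/matrixP => i j; rewrite !mxE.
pose u : 'cV[{mpoly R[n.+1]}]_n := \col_j (a j)%:MP.
have Mu : M *m u = 0.
  apply/matrixP => i k; rewrite !mxE.
  have /meridian_dvdP := invariant_iter i inv.
  rewrite iter_vf_op_sum hyperproj_sum => {2}<-; apply: eq_bigr => j _.
  by rewrite !mxE hyperprojZ mulrC mul_mpolyC.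
have [j aj] := unit_normal_neq0 ua.
have /matrixP/(_ j 0) : (\det M)%:M *m u = 0 by rewrite -mul_adj_mx -mulmxA Mu mulmx0.
rewrite mul_scalar_mx !mxE => /eqP; rewrite mulf_eq0 mpolyC_eq0 (negPf aj) orbF.
by move/eqP.
Qed.

(** A point of the hyperplane where G and H do not vanish shows that the prime
    [meridian a] divides neither, so all its powers in G E come from E. *)
Lemma has_multiplicityI chi G H (p : 'I_n.+1 -> R) mu :
    G * extactic (@meridian_basis R n) chi = H * meridian a ^+ mu ->
    (meridian a).@[p] = 0 -> G.@[p] != 0 -> H.@[p] != 0 ->
  has_multiplicity (@meridian_basis R n) chi (meridian a) mu.
Proof.
move=> GE lp Gp Hp.
have ndvd f : f.@[p] != 0 -> ~ mpdivides (meridian a) f.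
  by move=> fp /mpdivides_eval/(_ lp)/eqP; rewrite (negPf fp).
split.
- by exists a.
- apply: contraTneq Hp => E0; move: GE; rewrite E0 mulr0 => /esym/eqP.
  rewrite mulf_eq0 (negPf (expf_neq0 _ meridian_neq0)) orbF => /eqP->.
  by rewrite meval0 eqxx.
- apply: (meridian_dvd_cancel (ndvd _ Gp)).
  by exists H; rewrite mulrC.
- move=> mu' lt_mu /(mpdivides_exp_le lt_mu) [q Eq].
  apply: (ndvd _ Hp); exists (G * q); apply: (mulIf (expf_neq0 mu meridian_neq0)).
  by rewrite -GE Eq exprS; ring.
Qed.

End UnitNormal.
End MeridianForms.

(** * Fields of the form z Q on the sphere *)

Section LiftedFields.
Variables (R : realType) (n : nat).
Implicit Types (chi : vfield R n.+1) (Q : 'I_n -> {mpoly R[n.+1]}) (a : 'I_n -> R).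

Lemma vf_op_sphere chi :
  vf_op chi (sphere_poly R n) = \sum_i (chi i * 'X_i) *+ 2.
Proof.
rewrite /sphere_poly vf_opD vf_opN vf_op1 subr0 vf_op_sum; apply: eq_bigr => i _.
by rewrite expr2 vf_opM vf_opX; ring.
Qed.

(** The last component makes the field orthogonal to the position vector, hence
    tangent to all the spheres centred at the origin. *)
Definition lift_field Q : vfield R n.+1 := fun i =>
  if unlift ord_max i is Some j then 'X_ord_max * Q j
  else - \sum_(j < n) meridian_basis R j * Q j.

Lemma lift_fieldE Q j : lift_field Q (widen_ord (leqnSn n) j) = 'X_ord_max * Q j.
Proof. by rewrite /lift_field widen_lift liftK. Qed.

Lemma lift_field_max Q :
  lift_field Q ord_max = - \sum_(j < n) meridian_basis R j * Q j.
Proof. by rewrite /lift_field unlift_none. Qed.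

Lemma lift_field_basis Q j : vf_op (lift_field Q) (meridian_basis R j) = 'X_ord_max * Q j.
Proof. by rewrite vf_opX lift_fieldE. Qed.

Lemma lift_field_on_sphere Q : on_sphere (lift_field Q).
Proof.
exists 0; rewrite mul0r vf_op_sphere big_ord_recr /= lift_field_max.
rewrite (eq_bigr (fun j => ('X_ord_max * (meridian_basis R j * Q j)) *+ 2)) => [|j _].
  by rewrite sumrMnl -mulr_sumr; ring.
by rewrite lift_fieldE /meridian_basis; congr (_ *+ _); ring.
Qed.

Lemma msizeM_leq (f g : {mpoly R[n.+1]}) p q :
  (msize f <= p.+1)%N -> (msize g <= q)%N -> (msize (f * g) <= p + q)%N.
Proof.
move=> fp gq; case: (eqVneq f 0) => [->|f0]; first by rewrite mul0r msize0.
case: (eqVneq g 0) => [->|g0]; first by rewrite mulr0 msize0.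
by rewrite msizeM //; move: (leq_add fp gq); case: (msize f + msize g)%N.
Qed.

Lemma msizeXU (i : 'I_n.+1) : msize ('X_i : {mpoly R[n.+1]}) = 2%N.
Proof. by rewrite msizeX mdeg1. Qed.

Lemma mpolyXU_neq0 (i : 'I_n.+1) : 'X_i != 0 :> {mpoly R[n.+1]}.
Proof. by rewrite -msize_poly_eq0 msizeXU. Qed.

Lemma lift_field_degree Q m : (0 < m)%N -> (forall j, (msize (Q j) <= m)%N) ->
  (exists j, msize (Q j) = m) -> vf_degree (lift_field Q) = m.
Proof.
move=> m0 Qm [j Qj]; apply/eqP; rewrite /vf_degree eqn_leq; apply/andP; split.
  apply/bigmax_leqP => i _; rewrite -subn1 leq_subLR add1n.
  rewrite /lift_field; case: unliftP => [k _|_].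
    exact: (@msizeM_leq _ _ 1 m (eq_leq (msizeXU _)) (Qm k)).
  rewrite mmeasureN; apply: leq_trans (msize_sum _ _ _) _; apply/bigmax_leqP => k _.
  exact: (@msizeM_leq _ _ 1 m (eq_leq (msizeXU _)) (Qm k)).
have Qj0 : Q j != 0 by rewrite -msize_poly_eq0 Qj -lt0n.
apply: (@leq_trans (msize (lift_field Q (widen_ord (leqnSn n) j))).-1).
  by rewrite lift_fieldE msizeM ?mpolyXU_neq0 // msizeXU Qj.
exact: (leq_bigmax (F := fun i => (msize (lift_field Q i)).-1) (widen_ord (leqnSn n) j)).
Qed.

Definition coord_normal (j0 : 'I_n) : 'I_n -> R := fun j => (j == j0)%:R.

Lemma coord_normal_unit j0 : unit_normal (coord_normal j0).
Proof.
rewrite /unit_normal (bigD1 j0) //= big1 => [|j /negPf jj0].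
  by rewrite /coord_normal eqxx expr1n addr0.
by rewrite /coord_normal jj0 expr0n.
Qed.

Lemma meridian_coord j0 : meridian (coord_normal j0) = meridian_basis R j0.
Proof.
rewrite /meridian (bigD1 j0) //= big1 => [|j /negPf jj0].
  by rewrite /coord_normal eqxx scale1r addr0.
by rewrite /coord_normal jj0 scale0r.
Qed.

(** The all-ones point moved onto the j0-th coordinate hyperplane: no other
    coordinate form vanishes there. *)
Definition punctured_point (j0 : 'I_n) : 'I_n.+1 -> R :=
  fun i => (i != widen_ord (leqnSn n) j0)%:R.

Lemma punctured_basis j0 j : (meridian_basis R j).@[punctured_point j0] = (j != j0)%:R.
Proof. by rewrite mevalXU /punctured_point -(inj_eq val_inj) /= (inj_eq val_inj). Qed.

Lemma punctured_max j0 : ('X_ord_max : {mpoly R[n.+1]}).@[punctured_point j0] = 1.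
Proof.
rewrite mevalXU /punctured_point -(inj_eq val_inj) /=.
by rewrite gtn_eqF.
Qed.

Lemma zero_set_coord_inj : injective (fun j => zero_set (meridian (coord_normal j))).
Proof.
move=> i j eij; have : zero_set (meridian (coord_normal i)) (punctured_point i).
  by rewrite /zero_set /= meridian_coord punctured_basis eqxx.
rewrite eij /zero_set /= meridian_coord punctured_basis.
by case: (eqVneq j i) => // _ /eqP; rewrite oner_eq0.
Qed.

Lemma ndvd_X_max a : unit_normal a -> ~ mpdivides (meridian a) 'X_ord_max.
Proof.
move=> ua; rewrite meridian_dvdP // hyperprojX ambient_max scale0r subr0 => /eqP.
by rewrite (negPf (mpolyXU_neq0 _)).
Qed.

End LiftedFields.

(** * The diagonal field *)

Section Diagonal.
Variables (R : realType) (m n : nat).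
Hypothesis m_gt1 : (1 < m)%N.
Notation X := (@meridian_basis R n.+2).

Definition diag_field : vfield R n.+3 :=
  lift_field (fun j : 'I_n.+2 => (j : nat)%:R *: (X ord0 ^+ (m - 2) * X j)).

Let g : {mpoly R[n.+3]} := 'X_ord_max * X ord0 ^+ (m - 2).

Lemma diag_field_degree : vf_degree diag_field = m.
Proof.
have msX (j : 'I_n.+2) : msize (X ord0 ^+ (m - 2) * X j) = m.
  have := msize_meridianX (coord_normal_unit R (ord0 : 'I_n.+2)) (m - 2).
  rewrite meridian_coord => msk; rewrite msizeM ?expf_neq0 ?mpolyXU_neq0 //.
  by rewrite msk msizeXU; lia.
apply: lift_field_degree => [|j|]; first exact: ltnW.
  by apply: leq_trans (msizeZ_le _ _) _; rewrite msX.
by exists (lift ord0 ord0); rewrite scale1r msX.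
Qed.

(** The rates j being distinct integers, subtracting k times the current row at
    step k turns the powers j^k into falling factorials, and the matrix becomes
    triangular. *)
Lemma diag_field_extactic : extactic X diag_field =
  g ^+ 'C(n.+2, 2) * \prod_(j < n.+2) (j`!%:R *: X j).
Proof.
pose w (k : nat) (j : 'I_n.+2) := (j ^_ k)%:R *: X j.
have w0 j : w 0 j = X j by rewrite /w ffactn0 scale1r.
have wS k j : 1 * vf_op diag_field (w k j) = g * w k.+1 j + (g *+ k) * w k j.
  rewrite /w vf_opZ lift_field_basis mul1r -!mul_mpolyC -[g *+ k]mulr_natl /g.
  (* split the rate: j = k + (j - k), and (j - k) * j^_k = j^_(k + 1) *)
  case: (leqP k j) => kj; last first.
    by rewrite !ffact_small ?(leqW kj) ?mpolyC0 ?mul0r ?mulr0 ?addr0 //.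
  have -> : (j%:R : R) = k%:R + (j - k)%:R by rewrite -natrD subnKC.
  by rewrite ffactnSr natrM !mpolyCM !mpolyCD !mpolyC_nat; ring.
have := extactic_echelon w0 wS; rewrite expr1n mul1r => ->.
rewrite det_triu => [|i j ji]; last by rewrite mxE /w ffact_small // scale0r.
by congr (_ * _); apply: eq_bigr => i _; rewrite mxE /w ffactnn.
Qed.

Definition diag_multiplicity (j : 'I_n.+2) : nat :=
  if j == ord0 then (1 + (m - 2) * 'C(n.+2, 2))%N else 1%N.

Lemma diag_field_multiplicity j :
  has_multiplicity X diag_field (meridian (coord_normal R j)) (diag_multiplicity j).
Proof.
pose H := 'X_ord_max ^+ 'C(n.+2, 2) *
  (if j == ord0 then 1 else X ord0 ^+ ((m - 2) * 'C(n.+2, 2))) *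
  (j`!%:R%:MP * \prod_(i < n.+2 | i != j) (i`!%:R *: X i)).
apply: (@has_multiplicityI _ _ _ (coord_normal_unit R j) _ 1 H (punctured_point R j)).
- rewrite mul1r diag_field_extactic (bigD1 j) //= /H /g /diag_multiplicity.
  rewrite meridian_coord exprMn -exprM -mul_mpolyC.
  by case: eqP => [->|_]; rewrite ?exprD expr1; ring.
- by rewrite meridian_coord punctured_basis eqxx.
- by rewrite meval1 oner_eq0.
- rewrite /H !rmorphM !mulf_neq0 //.
  + by rewrite rmorphXn /= punctured_max expr1n oner_eq0.
  + case: (eqVneq j ord0) => [_|j0]; first by rewrite rmorph1 oner_eq0.
    by rewrite rmorphXn /= punctured_basis (eq_sym ord0) j0 expr1n oner_eq0.
  + by rewrite /= mevalC pnatr_eq0 -lt0n fact_gt0.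
  + rewrite rmorph_prod; apply/prodf_neq0 => i ij.
    by rewrite /= mevalZ punctured_basis ij mulr1 pnatr_eq0 -lt0n fact_gt0.
Qed.

(** The factors of the extactic polynomial are z and the coordinate forms, and
    z is not a meridian form. *)
Lemma diag_field_num_meridians :
  num_meridians diag_field (n.+2 + (m - 2) * 'C(n.+2, 2))%N.
Proof.
have inv j : Defs.invariant diag_field (meridian (coord_normal R j)).
  exists (j%:R *: g); rewrite meridian_coord lift_field_basis /g -!mul_mpolyC; ring.
exists n.+2, (@coord_normal R n.+2), diag_multiplicity; split.
- split; first exact: zero_set_coord_inj.
  by move=> i; split; [exact: coord_normal_unit|exact: inv|exact: diag_field_multiplicity].
- apply/seteqP; split=> [H [a [ua inva ->]]|_ [j _ <-]]; last first.
    by exists (coord_normal R j); split=> //; exact: coord_normal_unit.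
  suff [j aj] : exists j, mpdivides (meridian a) (X j).
    exists j => //; apply: (meridian_dvd_eqset ua (coord_normal_unit _ _)).
    by rewrite meridian_coord.
  have := invariant_dvd_extactic ua inva; rewrite diag_field_extactic.
  case/(meridian_dvdM ua) => [/(meridian_dvdX ua)/(meridian_dvdM ua)[/(ndvd_X_max ua)//|]|].
    by move/(meridian_dvdX ua); exists ord0.
  case/(meridian_dvd_prod ua) => j _ dj; exists j.
  move: dj; rewrite !meridian_dvdP // hyperprojZ => /eqP.
  by rewrite scaler_eq0 pnatr_eq0 -leqn0 leqNgt fact_gt0 => /eqP.
- rewrite big_ord_recl /diag_multiplicity eqxx (eq_bigr (fun=> 1%N)) //.
  by rewrite sum1_card card_ord; lia.
Qed.

End Diagonal.

(** * A rotation times a power of a meridian form *)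

Section Rotation.
Variables (R : realType) (m : nat).
Hypothesis m_gt1 : (1 < m)%N.
Notation X := (@meridian_basis R 3).
Let o0 : 'I_3 := ord0.
Let o1 : 'I_3 := lift ord0 ord0.
Let o2 : 'I_3 := ord_max.

Let rot (k : nat) (j : 'I_3) : {mpoly R[4]} :=
  iter k (fun p : 'I_3 -> {mpoly R[4]} =>
    fun j => if j == o1 then - p o2 else if j == o2 then p o1 else 0) X j.

Definition rotation_field : vfield R 4 := fun i =>
  if unlift ord_max i is Some j then X o0 ^+ (m - 1) * rot 1 j else 0.

Lemma rotation_field_basis j :
  vf_op rotation_field (X j) = X o0 ^+ (m - 1) * rot 1 j.
Proof. by rewrite vf_opX /rotation_field widen_lift liftK. Qed.

Lemma rotation_field_on_sphere : on_sphere rotation_field.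
Proof.
exists 0; rewrite mul0r vf_op_sphere big_ord_recr /= {2}/rotation_field unlift_none.
rewrite mul0r mul0rn addr0 !big_ord_recl big_ord0 /=.
rewrite /rotation_field !widen_lift !liftK /rot /=.
by rewrite /meridian_basis !widen_lift; ring.
Qed.

Lemma rotation_field_degree : vf_degree rotation_field = m.
Proof.
have ms (j : 'I_3) : msize (X o0 ^+ (m - 1) * X j) = m.+1.
  have := msize_meridianX (coord_normal_unit R o0) (m - 1).
  rewrite meridian_coord => msk; rewrite msizeM ?expf_neq0 ?mpolyXU_neq0 //.
  by rewrite msk msizeXU; lia.
apply/eqP; rewrite /vf_degree eqn_leq; apply/andP; split.
  apply/bigmax_leqP => i _; rewrite -subn1 leq_subLR add1n /rotation_field.
  case: unliftP => [k _|_]; last by rewrite msize0.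
  rewrite /rot /=; case: eqP => _; first by rewrite mulrN mmeasureN ms.
  by case: eqP => _; rewrite ?ms // mulr0 msize0.
have -> : m = (msize (rotation_field (widen_ord (leqnSn 3) o2))).-1.
  by rewrite /rotation_field widen_lift liftK /rot /= ms.
exact: (leq_bigmax (F := fun i => (msize (rotation_field i)).-1) (widen_ord (leqnSn 3) o2)).
Qed.

Lemma rotation_field_extactic : extactic X rotation_field =
  X o0 ^+ (3 * m - 2) * (X o1 ^+ 2 + X o2 ^+ 2).
Proof.
have w0 j : rot 0 j = X j by [].
have wS k j : 1 * vf_op rotation_field (rot k j)
  = X o0 ^+ (m - 1) * rot k.+1 j + 0 * rot k j.
  rewrite mul1r mul0r addr0.
  elim: k j => [|k IH] j; first exact: rotation_field_basis.
  rewrite /rot [iter k.+1 _ _]iterS [iter k.+2 _ _]iterS -/(rot k _).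
  have IH' := IH; rewrite /rot in IH'.
  case: eqP => _; first by rewrite vf_opN IH' mulrN.
  by case: eqP => _; rewrite ?IH' // vf_op0 mulr0.
have := @extactic_echelon _ _ _ _ _ _ _ (fun=> 0) _ w0 wS.
rewrite expr1n mul1r => ->.
have -> : (3 * m - 2 = (m - 1) * 'C(3, 2) + 1)%N by rewrite (_ : 'C(3, 2) = 3) //; lia.
rewrite exprD exprM expr1 -!mulrA; congr (_ * _).
rewrite (expand_det_col _ ord0) !big_ord_recl big_ord0 /cofactor !mxE /= !mul0r !addr0.
rewrite expr0 mul1r det2E !mxE /rot /=; ring.
Qed.

(** A hyperplane through the origin of R^3 contains a point off the axis
    x_2 = x_3 = 0, so no meridian form divides x_2^2 + x_3^2. *)
Lemma rotation_field_num_meridians : num_meridians rotation_field (3 * m - 2).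
Proof.
have inv : Defs.invariant rotation_field (meridian (coord_normal R o0)).
  by exists 0; rewrite meridian_coord rotation_field_basis /rot /= mulr0 mul0r.
exists 1%N, (fun=> coord_normal R o0), (fun=> 3 * m - 2)%N; split.
- split; first by move=> i j _; rewrite !ord1.
  move=> _; split; [exact: coord_normal_unit|exact: inv|].
  apply: (@has_multiplicityI _ _ _ (coord_normal_unit R o0) _ 1
    (X o1 ^+ 2 + X o2 ^+ 2) (punctured_point R o0)).
  + by rewrite mul1r rotation_field_extactic meridian_coord mulrC.
  + by rewrite meridian_coord punctured_basis eqxx.
  + by rewrite meval1 oner_eq0.
  + by rewrite mevalD !mevalM !punctured_basis /= !mulr1 -natrD pnatr_eq0.
- apply/seteqP; split=> [H [a [ua inva ->]]|_ [j _ <-]]; last first.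
    by exists (coord_normal R o0); split=> //; exact: coord_normal_unit.
  exists ord0 => //; apply: (meridian_dvd_eqset ua (coord_normal_unit _ _)).
  rewrite meridian_coord.
  have := invariant_dvd_extactic ua inva; rewrite rotation_field_extactic.
  case/(meridian_dvdM ua) => [/(meridian_dvdX ua)//|dvd_circ].
  have vanish (p : 'I_4 -> R) : \sum_j a j * p (widen_ord (leqnSn 3) j) = 0 ->
      p (widen_ord (leqnSn 3) o1) ^+ 2 + p (widen_ord (leqnSn 3) o2) ^+ 2 = 0.
    move=> lp; have := mpdivides_eval dvd_circ (p := p).
    by rewrite meval_meridian mevalD !rmorphXn /= !mevalXU; apply.
  (* two points of the hyperplane, one of which is off the axis x_2 = x_3 = 0 *)
  pose pt (x y z : R) (i : 'I_4) := nth 0 [:: x; y; z] i.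
  have := vanish (pt (- a o1) (a o0) 0); have := vanish (pt 0 (- a o2) (a o1)).
  rewrite !big_ord_recl !big_ord0 /pt /=.
  have := ua; rewrite /unit_normal !big_ord_recl big_ord0 /=.
  have -> : lift ord0 (lift ord0 ord0) = o2 by apply/val_inj.
  rewrite -/o0 -/o1.
  move=> u h1 h2.
  have {}h1 := h1 ltac:(ring).
  have {}h2 := h2 ltac:(ring).
  nra.
- by rewrite big_ord_recl big_ord0 addn0.
Qed.

End Rotation.

(** * A nilpotent chain, for degree two *)

Section Chain.
Variables (R : realType) (n : nat).
Notation X := (@meridian_basis R n.+2).

(** k-th iterate of the linear map which fixes the last basis variable and
    shifts the others down by one. *)
Definition chain (k : nat) (j : 'I_n.+2) : {mpoly R[n.+3]} :=
  if j == ord_max then X j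
  else if (k <= j)%N then X (inord (j - k)) else 0.

Definition chain_field : vfield R n.+3 := lift_field (chain 1).

Lemma chain_field_degree : vf_degree chain_field = 2%N.
Proof.
apply: lift_field_degree => [//|j|].
  rewrite /chain; case: eqP => _; first by rewrite msizeXU.
  by case: leqP => _; rewrite ?msizeXU ?msize0.
by exists ord_max; rewrite /chain eqxx msizeXU.
Qed.

Lemma chain_field_extactic : extactic X chain_field =
  'X_ord_max ^+ 'C(n.+2, 2) * (X ord0 ^+ n.+1 * X ord_max).
Proof.
have w0 j : chain 0 j = X j.
  by rewrite /chain; case: eqP => // _; rewrite subn0 inord_val.
have wS k j : 1 * vf_op chain_field (chain k j)
    = 'X_ord_max * chain k.+1 j + 0 * chain k j.
  rewrite mul1r mul0r addr0; case: (eqVneq j ord_max) => [->|/negPf jm].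
    by rewrite /chain eqxx lift_field_basis /chain eqxx.
  rewrite {1}/chain [chain k.+1 j]/chain jm.
  case: (leqP k j) => kj; last by rewrite vf_op0 leqNgt (leqW kj) /= mulr0.
  have jk : (j - k < n.+2)%N by apply: leq_ltn_trans (leq_subr _ _) (ltn_ord j).
  have jk' : (j - k.+1 < n.+2)%N by apply: leq_ltn_trans (leq_subr _ _) (ltn_ord j).
  rewrite lift_field_basis /chain; congr (_ * _).
  have -> : (inord (j - k) == ord_max :> 'I_n.+2) = false.
    apply/eqP => /(congr1 val); rewrite /= inordK // => jkn; move/eqP: jm; apply.
    by apply/val_inj => /=; have := ltn_ord j; lia.
  rewrite inordK // subn_gt0; case: ltnP => // _; congr X.
  by apply/val_inj; rewrite /= !inordK //; lia.
have := @extactic_echelon _ _ _ _ _ _ _ (fun=> 0) _ w0 wS.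
rewrite expr1n mul1r => ->; congr (_ * _).
rewrite det_triu => [|i j ji]; last first.
  rewrite mxE /chain; case: eqP => [jm|_]; last by rewrite leqNgt ji.
  by move: ji; rewrite jm /= ltnNge -ltnS ltn_ord.
rewrite big_ord_recr /= mxE /chain eqxx; congr (_ * _).
rewrite (eq_bigr (fun=> X ord0)) => [|i _]; first by rewrite prodr_const card_ord.
rewrite mxE -(inj_eq val_inj) /= ltn_eqF ?ltn_ord // leqnn subnn.
by congr X; apply/val_inj; rewrite /= inordK.
Qed.

Lemma chain_field_meridian_family :
  meridian_family chain_field (fun _ : 'I_1 => coord_normal R ord0) (fun=> n.+1).
Proof.
split=> [i j _|_]; first by rewrite !ord1.
split; first exact: coord_normal_unit.
  exists 0; rewrite meridian_coord lift_field_basis /chain -(inj_eq val_inj) /=.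
  by rewrite mulr0 mul0r.
apply: (@has_multiplicityI _ _ _ (coord_normal_unit R ord0) _ 1
   ('X_ord_max ^+ 'C(n.+2, 2) * X ord_max) (punctured_point R ord0)).
- by rewrite chain_field_extactic meridian_coord; ring.
- by rewrite meridian_coord punctured_basis eqxx.
- by rewrite meval1 oner_eq0.
- rewrite mevalM rmorphXn /= punctured_max punctured_basis -(inj_eq val_inj) /=.
  by rewrite expr1n mulr1 oner_eq0.
Qed.

End Chain.

(** * Derivatives of an inverse function at generic roots *)

Section TopCoefficient.
Variable R : nzRingType.
Implicit Types (p q : {poly R}).

(** No cancellation occurs in the extreme coefficient of a product, even when
    the degree bounds are not attained. *)
Lemma coefM_top p q a b : (size p <= a.+1)%N -> (size q <= b.+1)%N ->
  (p * q)`_(a + b) = p`_a * q`_b.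
Proof.
move=> pa qb; have la : (a < (a + b).+1)%N by rewrite ltnS leq_addr.
rewrite coefM (bigD1 (Ordinal la)) //= addKn big1 ?addr0 // => i ia.
case: (ltngtP i a) => [lia|gia|eia].
- by rewrite [q`__]nth_default ?mulr0 // (leq_trans qb) //; lia.
- by rewrite [p`__]nth_default ?mul0r // (leq_trans pa).
- by case/eqP: ia; apply/val_inj.
Qed.

Lemma size_polyM_leq p q a b : (size p <= a.+1)%N -> (size q <= b.+1)%N ->
  (size (p * q)%R <= (a + b).+1)%N.
Proof.
move=> pa qb; apply: leq_trans (size_polyMleq _ _) _.
by move: pa qb; case: (size p) => [|s]; case: (size q) => [|t] /=; lia.
Qed.

End TopCoefficient.

Section InverseJet.
Variable R : numFieldType.
Implicit Types (G : {poly R}).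

(** If G = F', the k-th derivative of the inverse function s = s(F) is
    [inverse_jet G k] / G^(2 k), evaluated at s. *)
Fixpoint inverse_jet G (k : nat) : {poly R} :=
  if k is k'.+1 then
    G * (inverse_jet G k')^`() - (G^`() * inverse_jet G k') *+ (2 * k')
  else 'X.

(** With D = deg F, going from k to k + 1 multiplies the extreme coefficient by
    (1 - k D) times that of G, and k D = 1 is impossible when D > 1. *)
Lemma inverse_jet_neq0 G k : (1 < size G)%N -> inverse_jet G k != 0.
Proof.
case sG: (size G) => [|[|d]] // _.
have lG : G`_d.+1 != 0 by rewrite -[d.+1]/(d.+2.-1) -sG -lead_coefE lead_coef_eq0 -size_poly_eq0 sG.
have sG' : (size G^`() <= d.+1)%N by rewrite (leq_trans (size_poly _ _)) ?sG.
suff [_] : (size (inverse_jet G k) <= (k * d).+2)%N /\ (inverse_jet G k)`_(k * d).+1 != 0.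
  by apply: contraNneq => ->; rewrite coef0.
elim: k => [|k [sk ck]] /=; first by rewrite mul0n size_polyX coefX oner_neq0.
set M := inverse_jet G k in sk ck *.
have sM' : (size M^`() <= (k * d).+1)%N.
  by rewrite (leq_trans (size_poly _ _)) //; move: sk; case: (size M).
have e1 : ((k.+1 * d).+1 = d.+1 + k * d)%N by rewrite mulSn.
have e2 : ((k.+1 * d).+1 = d + (k * d).+1)%N by rewrite mulSn addnS.
split.
  rewrite (leq_trans (size_polyD _ _)) // geq_max size_polyN.
  rewrite {1}e1 size_polyM_leq ?sG //=.
  rewrite -scaler_nat (leq_trans (size_scale_leq _ _)) //.
  by rewrite e2 size_polyM_leq.
rewrite coefB coefMn {1}e1 e2 !coefM_top ?sG // !coef_deriv.
set lM := M`__ in ck *; set lG' := G`__ in lG *.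
rewrite (_ : _ - _ = lG' * lM * ((k * d).+1%:R - (d.+1 * (2 * k))%:R)); last first.
  by rewrite natrM -[_ *+ (2 * k)]mulr_natr -[lM *+ _]mulr_natr -[lG' *+ _]mulr_natr; ring.
rewrite !mulf_neq0 // subr_eq0 eqr_nat; apply/eqP => e.
have {e} : (k * d + 2 * k = 1)%N by clear -e; lia.
by clear; case: k => [|k]; nia.
Qed.

End InverseJet.

Section ShiftedRoots.
Variable R : realType.

(** Its roots are the even numbers, and at odd integers its value is an integer
    of absolute value at least 1: it keeps d real roots after subtraction of any
    constant between 0 and 1. *)
Definition even_roots_poly (d : nat) : {poly R} := \prod_(k < d) ('X - (k.*2)%:R%:P).

Lemma size_even_roots_poly d : size (even_roots_poly d) = d.+1.
Proof.
rewrite /even_roots_poly -(big_mkord xpredT (fun k => 'X - (k.*2)%:R%:P)).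
by rewrite size_prod_XsubC size_iota subn0.
Qed.

Lemma even_roots_poly_int d (z : int) :
  (even_roots_poly d).[z%:~R] = (\prod_(k < d) (z - (k.*2)%:Z))%:~R.
Proof.
rewrite horner_prod rmorph_prod; apply: eq_bigr => k _ /=.
by rewrite !hornerE rmorphB.
Qed.

(** Consecutive odd integers around 2 k give values of opposite signs and
    absolute value at least 1, so subtracting c does not change these signs. *)
Lemma even_roots_poly_root d (c : R) (k : 'I_d) : 0 < c < 1 ->
  exists x, [/\ (k.*2)%:R - 1 < x, x < (k.*2)%:R + 1 & root (even_roots_poly d - c%:P) x].
Proof.
move=> /andP[c0 c1]; set F := even_roots_poly d.
pose P (z : int) := \prod_(k < d) (z - (k.*2)%:Z).
have FP (z : int) : F.[z%:~R] = (P z)%:~R by exact: even_roots_poly_int.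
set l : int := k.*2%:Z - 1; set r : int := k.*2%:Z + 1.
have Plr : P l * P r < 0.
  rewrite /P -big_split (bigD1 k) //= /l /r.
  rewrite nmulr_rlt0; last by rewrite (_ : _ * _ = -1) //; ring.
  apply: prodr_gt0 => i ik.
  have : (i : nat) != k by [].
  by nia.
have : (1 <= P l /\ P r <= -1) \/ (P l <= -1 /\ 1 <= P r).
  move: Plr; case: (ltrgt0P (P l)) => [Pl|Pl|->]; last by rewrite mul0r ltxx.
    by rewrite pmulr_rlt0 // => Pr; left; lia.
  by rewrite nmulr_rlt0 // => Pr; right; lia.
have lrR : (l%:~R : R) <= r%:~R by rewrite ler_int /l /r; lia.
have lE : (k.*2)%:R - 1 = l%:~R :> R by rewrite /l rmorphB.
have rE : (k.*2)%:R + 1 = r%:~R :> R by rewrite /r rmorphD.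
have ends x : l%:~R <= x <= r%:~R -> root (F - c%:P) x ->
    1 <= `|P l| -> 1 <= `|P r| -> [/\ l%:~R < x, x < r%:~R & root (F - c%:P) x].
  move=> /andP[lx xr] rx.
  have nroot z : 1 <= `|P z| -> z%:~R != x.
    move=> Pz; apply: contraTneq rx => <-.
    rewrite rootE !hornerE FP subr_eq0; apply/eqP => Pc.
    move: Pz; rewrite -(ler_int R) intr_norm Pc ger0_norm ?(ltW c0) //.
    by rewrite leNgt c1.
  by move=> /nroot zl /nroot zr; split=> //; rewrite lt_neqAle ?lx ?xr ?zl // eq_sym zr.
rewrite lE rE; case=> [[Pl Pr]|[Pl Pr]].
  have [|x xlr rx] := @poly_ivt R (- (F - c%:P)) _ _ lrR.
    rewrite !hornerE !FP; move: Pl Pr; rewrite -!(ler_int R) => Pl Pr.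
    by apply/andP; split; lra.
  by rewrite rootN in rx; exists x; apply: (ends _ xlr rx); lia.
have [|x xlr rx] := @poly_ivt R (F - c%:P) _ _ lrR.
  rewrite !hornerE !FP; move: Pl Pr; rewrite -!(ler_int R) => Pl Pr.
  by apply/andP; split; lra.
by exists x; apply: (ends _ xlr rx); lia.
Qed.

Lemma even_roots_poly_shift d (c : R) : (0 < d)%N -> 0 < c < 1 ->
  exists s : seq R, [/\ uniq s, size s = d &
    even_roots_poly d - c%:P = \prod_(x <- s) ('X - x%:P)].
Proof.
move=> d0 c01; have [x xP] := boolp.choice (fun k : 'I_d => even_roots_poly_root k c01).
have sF : size (even_roots_poly d) = d.+1 by rewrite size_even_roots_poly.
have sc : (size (- c%:P) < size (even_roots_poly d))%N.
  by rewrite size_polyN sF ltnS (leq_trans (size_polyC_leq1 _)).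
have us : uniq [seq x k | k <- enum 'I_d].
  rewrite map_inj_uniq ?enum_uniq //.
  have lt_x (k l : 'I_d) : (k < l)%N -> x k < x l.
    move=> kl; have [_ xk _] := xP k; have [xl _ _] := xP l.
    apply: lt_trans xk (le_lt_trans _ xl).
    have : (k.*2 + 2)%:R <= (l.*2)%:R :> R by rewrite ler_nat; lia.
    by rewrite natrD; lra.
  move=> k l xkl; apply/val_inj; case: (ltngtP k l) => // /lt_x;
    by rewrite xkl ltxx.
exists [seq x k | k <- enum 'I_d]; split=> //; first by rewrite size_map size_enum_ord.
have lc : lead_coef (even_roots_poly d - c%:P) = 1.
  by rewrite lead_coefDl // lead_coef_prod big1 // => k _; rewrite lead_coefXsubC.
rewrite -[RHS]scale1r -lc; apply: all_roots_prod_XsubC.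
- by rewrite size_polyDl // sF size_map size_enum_ord.
- by apply/allP => _ /mapP[k _ ->]; have [] := xP k.
- by rewrite uniq_rootsE.
Qed.

(** Distinct constants c give disjoint sets of roots, and M has finitely many
    roots, so one of more than deg M constants is good. *)
Lemma even_roots_poly_generic d (M : {poly R}) : (0 < d)%N -> M != 0 ->
  exists c (s : seq R), [/\ uniq s, size s = d,
    even_roots_poly d - c%:P = \prod_(x <- s) ('X - x%:P)
    & forall x, x \in s -> M.[x] != 0].
Proof.
move=> d0 M0; apply: contrapT => noc.
(* size M exceeds the number of roots of M by at least one *)
pose c (i : 'I_(size M)) : R := i.+2%:R^-1.
have c01 i : 0 < c i < 1.
  by rewrite /c invr_gt0 ltr0Sn /= invf_lt1 ?ltr0Sn // ltr1n.
have bad i : exists x, root M x /\ (even_roots_poly d).[x] = c i.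
  have [s [us ss Fs]] := even_roots_poly_shift d0 (c01 i).
  apply: contrapT => nox; apply: noc; exists (c i), s; split=> // x xs.
  apply/negP => Mx; apply: nox; exists x; split=> //.
  have : (even_roots_poly d - (c i)%:P).[x] = 0.
    by apply/rootP; rewrite Fs root_prod_XsubC.
  by rewrite !hornerE => /eqP; rewrite subr_eq0 => /eqP.
have [x xP] := boolp.choice bad.
have xI : injective x.
  move=> i j xij; have [_ ci] := xP i; have [_ cj] := xP j.
  move: cj; rewrite -xij ci /c => /invr_inj/eqP; rewrite eqr_nat => /eqP[ij].
  exact/val_inj.
have := @max_poly_roots _ M [seq x i | i <- enum 'I_(size M)] M0.
rewrite map_inj_uniq // enum_uniq size_map size_enum_ord ltnn.
have -> : all (root M) [seq x i | i <- enum 'I_(size M)].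
  by apply/allP => _ /mapP[i _ ->]; have [] := xP i.
by move=> /(_ isT isT).
Qed.

Lemma size_even_roots_poly_deriv d : (0 < d)%N -> size (even_roots_poly d)^`() = d.
Proof.
case: d => // d _; have sF : size (even_roots_poly d.+1) = d.+2.
  by rewrite size_even_roots_poly.
apply/eqP; rewrite eqn_leq (leq_trans (size_poly _ _)) ?sF //=.
rewrite ltnNge; apply/negP => /leq_sizeP/(_ d (leqnn _))/eqP.
have -> : (even_roots_poly d.+1)^`()`_d = lead_coef (even_roots_poly d.+1) *+ d.+1.
  by rewrite coef_deriv lead_coefE sF.
by rewrite mulrn_eq0 /= lead_coef_eq0 -size_poly_eq0 sF.
Qed.

End ShiftedRoots.

(** * The pencil field, for degree at least three *)

Section Pencil.
Variables (R : realType) (n : nat) (s : seq R).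
Notation X := (@meridian_basis R n.+2).
(* u is the variable of index i0, and s that of index iS *)
Let i0 : 'I_n.+3 := widen_ord (leqnSn n.+2) ord0.
Let iS : 'I_n.+3 := widen_ord (leqnSn n.+2) ord_max.

Lemma u_neq_s : (i0 == iS) = false. Proof. by rewrite -(inj_eq val_inj). Qed.
Lemma z_neq_s : (ord_max == iS) = false.
Proof. by rewrite -(inj_eq val_inj) /= gtn_eqF. Qed.

(** Restriction to the line where all the variables but s are 1; a form in s and
    u is dehomogenised in this way. *)
Definition slice (p : {mpoly R[n.+3]}) : {poly R} :=
  mmap (@polyC R) (fun i => if i == iS then 'X else 1) p.

Definition slice_point (x : R) (i : 'I_n.+3) : R := if i == iS then x else 1.

Lemma sliceXm m : slice 'X_[m] = 'X^(m iS).
Proof.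
rewrite /slice mmapX /mmap1 (bigD1 iS) //= eqxx big1 ?mulr1 // => i /negPf ->.
by rewrite expr1n.
Qed.

Lemma sliceD : {morph slice : p q / p + q}. Proof. exact: mmapD. Qed.
Lemma sliceM : {morph slice : p q / p * q}.
Proof. by move=> p q; rewrite /slice rmorphM. Qed.
Lemma sliceB : {morph slice : p q / p - q}. Proof. exact: mmapB. Qed.
Lemma sliceMn k : {morph slice : p / p *+ k}. Proof. exact: mmapMn. Qed.
Lemma sliceZ c p : slice (c *: p) = c *: slice p.
Proof. by rewrite /slice mmapZ mul_polyC. Qed.

(** Only the variable s moves along the line. *)
Lemma slice_deriv p : slice p^`M(iS) = (slice p)^`().
Proof.
elim/mpolyind: p => [|c m p _ _ IH]; first by rewrite mderiv0 /slice mmap0 deriv0.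
rewrite mderivD !sliceD derivD IH mderivZ !sliceZ derivZ mderivX sliceZ !sliceXm.
by rewrite mnmBE mnm1E eqxx subn1 derivXn scaler_nat.
Qed.

Lemma meval_slice p x : p.@[slice_point x] = (slice p).[x].
Proof.
elim/mpolyind: p => [|c m p _ _ IH]; first by rewrite meval0 /slice mmap0 horner0.
rewrite mevalD sliceD hornerD IH mevalZ sliceZ hornerZ sliceXm hornerXn; congr (_ * _ + _).
rewrite mevalX /slice_point (bigD1 iS) //= eqxx big1 ?mulr1 // => i /negPf ->.
by rewrite expr1n.
Qed.

(** Polynomials in s and u only, described by derivatives so that stability
    under differentiation is immediate. *)
Definition planar (p : {mpoly R[n.+3]}) : Prop :=
  forall i, i != i0 -> i != iS -> p^`M(i) = 0.

Lemma planarB p q : planar p -> planar q -> planar (p - q).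
Proof. by move=> pp pq i ii0 iiS; rewrite mderivB pp // pq // subrr. Qed.

Lemma planarM p q : planar p -> planar q -> planar (p * q).
Proof. by move=> pp pq i ii0 iiS; rewrite mderivM pp // pq // mul0r mulr0 addr0. Qed.

Lemma planarMn p k : planar p -> planar (p *+ k).
Proof. by move=> pp i ii0 iiS; rewrite mderivMn pp // mul0rn. Qed.

Lemma planar_deriv p : planar p -> planar p^`M(iS).
Proof. by move=> pp i ii0 iiS; rewrite mderiv_comm pp // mderiv0. Qed.

Lemma planarX j : (j == i0) || (j == iS) -> planar 'X_j.
Proof.
move=> j0S i ii0 iiS; rewrite mderivX mnm1E.
case: eqP => [ji|_]; last by rewrite scale0r.
by move: j0S; rewrite ji (negPf ii0) (negPf iiS).
Qed.

Definition pencil_form (x : R) : {mpoly R[n.+3]} := X ord_max - x *: X ord0.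

Definition pencil_prod : {mpoly R[n.+3]} := \prod_(x <- s) pencil_form x.

Let f := pencil_prod.
Let fs := f^`M(iS).
Let fss := fs^`M(iS).

Lemma pencil_formP x : pencil_form x = X ord_max - x%:MP * X ord0.
Proof. by rewrite mul_mpolyC. Qed.

Lemma planar_form x : planar (pencil_form x).
Proof.
rewrite pencil_formP; apply: planarB; first by apply: planarX; rewrite eqxx orbT.
apply: planarM; last by apply: planarX; rewrite eqxx.
by move=> i _ _; rewrite mderivC.
Qed.

Lemma planar_prod : planar f.
Proof.
rewrite /f /pencil_prod; elim: s => [|x r IH].
  by rewrite big_nil => i _ _; rewrite -mpolyC1 mderivC.
by rewrite big_cons; apply: planarM => //; apply: planar_form.
Qed.

Lemma slice_form x : slice (pencil_form x) = 'X - x%:P.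
Proof.
rewrite sliceB sliceZ !sliceXm !mnm1E !eqxx u_neq_s.
by rewrite alg_polyC.
Qed.

Lemma slice_prod : slice f = \prod_(x <- s) ('X - x%:P).
Proof.
rewrite /f /pencil_prod; elim: s => [|x r IH].
  by rewrite !big_nil /slice rmorph1.
by rewrite !big_cons sliceM IH slice_form.
Qed.

(** [inverse_jet] for the binary form f, with partial derivatives in s. *)
Fixpoint pencil_jet (k : nat) : {mpoly R[n.+3]} :=
  if k is k'.+1 then fs * (pencil_jet k')^`M(iS) - (fss * pencil_jet k') *+ (2 * k')
  else X ord_max.

Lemma planar_jet k : planar (pencil_jet k).
Proof.
have pfs := planar_deriv planar_prod.
elim: k => [|k IH] /=; first by apply: planarX; rewrite eqxx orbT.
apply: planarB; first by apply: planarM => //; apply: planar_deriv.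
by apply: planarMn; apply: planarM => //; apply: planar_deriv.
Qed.

Lemma slice_jet k :
  slice (pencil_jet k) = inverse_jet (\prod_(x <- s) ('X - x%:P))^`() k.
Proof.
elim: k => [|k IH] /=; first by rewrite sliceXm mnm1E eqxx expr1.
by rewrite sliceB sliceMn !sliceM !slice_deriv IH slice_prod.
Qed.

Definition pencil_field : vfield R n.+3 :=
  lift_field (fun j : 'I_n.+2 => if j == ord_max then f else j%:R *: (fs * X j)).

Let z : {mpoly R[n.+3]} := 'X_ord_max.

Lemma pencil_field_max : vf_op pencil_field (X ord_max) = z * f.
Proof. by rewrite lift_field_basis eqxx. Qed.

Lemma pencil_field_basis j : j != ord_max ->
  vf_op pencil_field (X j) = z * (j%:R *: (fs * X j)).
Proof. by move=> /negPf jm; rewrite lift_field_basis jm. Qed.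

Lemma pencil_field_planar p : planar p -> vf_op pencil_field p = z * f * p^`M(iS).
Proof.
move=> pp; rewrite /vf_op (bigD1 iS) //= big1 ?addr0 => [|i iiS].
  by rewrite -[pencil_field iS]vf_opX pencil_field_max.
case: (eqVneq i i0) => [->|ii0]; last by rewrite pp // mulr0.
rewrite -[pencil_field i0]vf_opX pencil_field_basis ?scale0r ?mulr0 ?mul0r //.
Qed.

Let w (k : nat) (j : 'I_n.+2) : {mpoly R[n.+3]} :=
  if j == ord_max then f ^+ k * pencil_jet k
  else (j ^_ k)%:R *: (X j * fs ^+ (2 * k)).

Let h (k : nat) := z * (fs ^+ 2 *+ k + f * fss *+ (2 * k)).

(** In terms of D = d/df, the row w_k is f^k f_s^(2 k) D^k applied to the
    coordinates s and f^j (the variable X_j standing for f^j), and the field is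
    z f f_s D; h_k is the logarithmic derivative of the factor f^k f_s^(2 k),
    times f_s. *)
Lemma pencil_recurrence k j :
  fs * vf_op pencil_field (w k j) = z * w k.+1 j + h k * w k j.
Proof.
have chi_f : vf_op pencil_field f = z * f * fs by rewrite pencil_field_planar //; apply: planar_prod.
have chi_fs : vf_op pencil_field fs = z * f * fss.
  by rewrite pencil_field_planar //; apply/planar_deriv/planar_prod.
rewrite /w /h; case: (eqVneq j ord_max) => [_|jm].
  have chi_jet := pencil_field_planar (@planar_jet k).
  case: k chi_jet => [|k] chi_jet.
    by rewrite expr0 mul1r chi_jet /= !mulr0n; ring.
  rewrite vf_opM chi_jet vf_opXn chi_f [pencil_jet k.+2]/= -/(pencil_jet k.+1).
  rewrite !exprS; ring.
rewrite vf_opZ vf_opM pencil_field_basis // -!mul_mpolyC.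
have chi_fsk : fs * vf_op pencil_field (fs ^+ (2 * k)) = (2 * k)%:R * (z * f * fss) * fs ^+ (2 * k).
  case: k => [|k]; first by rewrite expr0 vf_op1; ring.
  by rewrite mulnSr addn2 vf_opXn chi_fs -mulr_natl !exprS; ring.
case: (leqP k j) => kj; last first.
  by rewrite !ffact_small ?(leqW kj) ?mpolyC0 ?mul0r ?mulr0 ?addr0.
have -> : (j%:R : R) = k%:R + (j - k)%:R by rewrite -natrD subnKC.
rewrite ffactnSr natrM !mpolyCM !mpolyCD !mpolyC_nat.
rewrite -[fs ^+ 2 *+ k]mulr_natl -[f * fss *+ _]mulr_natl natrM mulnSr exprD.
rewrite [X in _ = X](_ : _ = (j ^_ k)%:R * (z * (k%:R + (j - k)%:R) * fs * (fs * X j) * fs ^+ (2 * k)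
    + X j * ((2 * k)%:R * (z * f * fss) * fs ^+ (2 * k)))); last by rewrite natrM; ring.
rewrite -chi_fsk; ring.
Qed.

Lemma pencil_field_extactic :
  fs ^+ 'C(n.+2, 2) * extactic X pencil_field =
  z ^+ 'C(n.+2, 2) * ((\prod_(k < n.+1) (k`!%:R *: (X (widen_ord (leqnSn n.+1) k) * fs ^+ (2 * k))))
     * (f ^+ n.+1 * pencil_jet n.+1)).
Proof.
have w0 j : w 0 j = X j.
  rewrite /w; case: eqP => [->|_]; first by rewrite expr0 mul1r.
  by rewrite ffactn0 scale1r mulr1.
rewrite (extactic_echelon w0 pencil_recurrence); congr (_ * _).
rewrite det_triu => [|i j ji]; last first.
  rewrite mxE /w; case: eqP => [jm|_]; last by rewrite ffact_small ?scale0r.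
  by move: ji; rewrite jm /= ltnNge -ltnS ltn_ord.
rewrite big_ord_recr /= mxE /w eqxx; congr (_ * _).
apply: eq_bigr => k _; rewrite mxE -(inj_eq val_inj) /= ltn_eqF ?ltn_ord //.
by rewrite ffactnn.
Qed.

Lemma pencil_form_msize x : msize (pencil_form x) = 2%N.
Proof.
apply/eqP; rewrite eqn_leq; apply/andP; split.
  apply: leq_trans (msizeD_le _ _) _; rewrite geq_max mmeasureN msizeXU /=.
  by apply: leq_trans (msizeZ_le _ _) _; rewrite msizeXU.
rewrite ltnNge; apply/negP => /msize1_polyC pC.
have := congr1 slice pC; rewrite slice_form /slice mmapC => /(congr1 (fun p : {poly R} => size p)).
by rewrite size_XsubC => sz; have := size_polyC_leq1 ((pencil_form x)@_0%MM); rewrite -sz.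
Qed.

Lemma pencil_prod_msize : msize f = (size s).+1.
Proof.
rewrite /f /pencil_prod; elim: s => [|x r IH]; first by rewrite big_nil msize1.
have p0 p : (0 < msize p)%N -> p != 0 :> {mpoly R[n.+3]}.
  by rewrite lt0n msize_poly_eq0.
by rewrite big_cons msizeM ?p0 ?IH ?pencil_form_msize.
Qed.

Lemma msize_mderiv i (p : {mpoly R[n.+3]}) : (msize p^`M(i) <= (msize p).-1)%N.
Proof.
rewrite [X in (X <= _)%N]msizeE; apply/bigmax_leqP_seq => m mp _.
move: mp; rewrite mcoeff_msupp mcoeff_deriv mulrn_eq0 /= => pm.
have : (mdeg (m + U_(i)) < msize p)%N.
  by rewrite ltnNge; apply: contra pm => /msize_mdeg_ge; rewrite -mcoeff_eq0.
by rewrite mdegD mdeg1 addn1; case: (msize p).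
Qed.

Lemma pencil_field_degree : s != [::] -> vf_degree pencil_field = (size s).+1.
Proof.
move=> s0; apply: lift_field_degree => // [j|]; last by exists ord_max; rewrite eqxx pencil_prod_msize.
case: eqP => _; first by rewrite pencil_prod_msize.
apply: leq_trans (msizeZ_le _ _) _.
case ss : (size s) => [|d]; first by move: s0; rewrite -size_eq0 ss.
rewrite -[d.+2]addn2; apply: (@msizeM_leq _ _ fs (X j) d 2); last by rewrite msizeXU.
by apply: leq_trans (msize_mderiv _ _) _; rewrite pencil_prod_msize ss.
Qed.

Definition pencil_normal (x : R) : 'I_n.+2 -> R := fun j =>
  (Num.sqrt (1 + x ^+ 2))^-1 * ((j == ord_max)%:R - x * (j == ord0)%:R).

Lemma sqrt_gt0 (x : R) : 0 < Num.sqrt (1 + x ^+ 2).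
Proof. by rewrite sqrtr_gt0 ltr_pwDl ?sqr_ge0. Qed.

Lemma pencil_normal_max x : pencil_normal x ord_max = (Num.sqrt (1 + x ^+ 2))^-1.
Proof. by rewrite /pencil_normal eqxx /= mulr0 subr0 mulr1. Qed.

Lemma pencil_normal_0 x :
  pencil_normal x ord0 = - ((Num.sqrt (1 + x ^+ 2))^-1 * x).
Proof. by rewrite /pencil_normal eqxx /= mulr1 sub0r mulrN. Qed.

Lemma pencil_normal_other x j : j != ord_max -> j != ord0 -> pencil_normal x j = 0.
Proof. by rewrite /pencil_normal => /negPf -> /negPf ->; rewrite mulr0 subr0 mulr0. Qed.

Lemma pencil_normal_unit x : unit_normal (pencil_normal x).
Proof.
rewrite /unit_normal (bigD1 ord_max) //= (bigD1 ord0) //= big1 => [|j /andP[jm j0]].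
  rewrite pencil_normal_max pencil_normal_0 addr0 sqrrN exprMn -[X in X + _]mulr1 -mulrDr.
  rewrite exprVn sqr_sqrtr ?addr_ge0 ?sqr_ge0 // mulVf //.
  by rewrite gt_eqF // ltr_pwDl ?sqr_ge0.
by rewrite pencil_normal_other // expr0n.
Qed.

Lemma meridian_pencil x :
  meridian (pencil_normal x) = (Num.sqrt (1 + x ^+ 2))^-1 *: pencil_form x.
Proof.
rewrite /meridian (bigD1 ord_max) //= (bigD1 ord0) //= big1 => [|j /andP[jm j0]].
  by rewrite pencil_normal_max pencil_normal_0 addr0 /pencil_form scalerBr scalerA scaleNr.
by rewrite pencil_normal_other // scale0r.
Qed.

Lemma meval_pencil x y : (pencil_form x).@[slice_point y] = y - x.
Proof. by rewrite meval_slice slice_form !hornerE. Qed.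

Lemma meval_meridian_pencil x y :
  (meridian (pencil_normal x)).@[slice_point y] = (Num.sqrt (1 + x ^+ 2))^-1 * (y - x).
Proof. by rewrite meridian_pencil mevalZ meval_pencil. Qed.

Lemma zero_set_pencil_inj : injective (fun x => zero_set (meridian (pencil_normal x))).
Proof.
move=> x y exy; have : zero_set (meridian (pencil_normal x)) (slice_point x).
  by rewrite /zero_set /= meval_meridian_pencil subrr mulr0.
rewrite exy /zero_set /= meval_meridian_pencil => /eqP.
by rewrite mulf_eq0 invr_eq0 (gt_eqF (sqrt_gt0 y)) subr_eq0 => /eqP.
Qed.

(** Simplicity of the root x gives both f = (unit at the point) * form and
    f_s <> 0 at the point. *)
Lemma pencil_field_multiplicity x : uniq s -> x \in s -> (pencil_jet n.+1).@[slice_point x] != 0 ->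
  has_multiplicity X pencil_field (meridian (pencil_normal x)) n.+1.
Proof.
move=> us xs jx; set r := Num.sqrt (1 + x ^+ 2).
have r0 : r != 0 by rewrite gt_eqF // sqrt_gt0.
pose g := \prod_(y <- rem x s) pencil_form y.
have fE : f = g * pencil_form x.
  by rewrite /f /pencil_prod (perm_big _ (perm_to_rem xs)) big_cons mulrC.
have fEl : f = (r%:MP * g) * meridian (pencil_normal x).
  rewrite fE meridian_pencil -/r -(mul_mpolyC r^-1) -[LHS]mul1r -mpolyC1 -(divff r0) mpolyCM; ring.
have gx : g.@[slice_point x] != 0.
  rewrite /g rmorph_prod prodf_seq_neq0; apply/allP => y /=.
  rewrite mem_rem_uniq // inE => /andP[yx _].
  by rewrite /= meval_pencil subr_eq0 eq_sym.
have fsx : fs.@[slice_point x] != 0.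
  rewrite /fs fE mderivM mevalD mevalM meval_pencil subrr mulr0 add0r mevalM.
  rewrite mulf_neq0 // meval_slice slice_deriv slice_form derivXsubC hornerC.
  by rewrite oner_eq0.
have zx : z.@[slice_point x] != 0.
  by rewrite /z mevalXU /slice_point z_neq_s oner_eq0.
apply: (@has_multiplicityI _ _ _ (pencil_normal_unit x) _ (fs ^+ 'C(n.+2, 2))
   (z ^+ 'C(n.+2, 2) * ((\prod_(k < n.+1) (k`!%:R *: (X (widen_ord (leqnSn n.+1) k) * fs ^+ (2 * k))))
     * ((r%:MP * g) ^+ n.+1 * pencil_jet n.+1))) (slice_point x)).
- by rewrite pencil_field_extactic [in LHS]fEl exprMn; ring.
- by rewrite meval_meridian_pencil subrr mulr0.
- by rewrite rmorphXn expf_neq0.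
- rewrite !mevalM !rmorphXn /= mevalM mevalC.
  rewrite !mulf_neq0 ?expf_neq0 ?mulf_neq0 //.
  rewrite rmorph_prod; apply/prodf_neq0 => k _.
  rewrite /= mevalZ mulf_neq0 ?pnatr_eq0 -?lt0n ?fact_gt0 // mevalM rmorphXn /=.
  rewrite mulf_neq0 ?expf_neq0 // mevalXU /slice_point -(inj_eq val_inj) /=.
  by rewrite ltn_eqF ?ltn_ord // oner_eq0.
Qed.

Lemma pencil_field_family : uniq s ->
  (forall x, x \in s -> (inverse_jet (\prod_(y <- s) ('X - y%:P))^`() n.+1).[x] != 0) ->
  meridian_family pencil_field (fun k : 'I_(size s) => pencil_normal s`_k) (fun=> n.+1).
Proof.
move=> us js; split=> [k l /zero_set_pencil_inj/eqP|k].
  by rewrite nth_uniq // => /eqP/val_inj.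
have ks : s`_k \in s by rewrite mem_nth.
split; first exact: pencil_normal_unit.
  exists (z * (\prod_(y <- rem s`_k s) pencil_form y)).
  rewrite meridian_pencil vf_opZ pencil_field_planar; last exact: planar_form.
  have -> : (pencil_form s`_k)^`M(iS) = 1.
    rewrite /pencil_form mderivB mderivZ !mderivX !mnm1E eqxx eq_sym.
    rewrite [iS == _]eq_sym u_neq_s scale0r scaler0 subr0 scale1r.
    by rewrite -{1}[U_(_)%MM]add0m addmK mpolyX0.
  rewrite /f /pencil_prod (perm_big _ (perm_to_rem ks)) big_cons /= -!mul_mpolyC; ring.
by apply: pencil_field_multiplicity => //; rewrite meval_slice slice_jet js.
Qed.

End Pencil.

Lemma exists_pencil_field (R : realType) (n d : nat) : (1 < d)%N ->
  exists chi : vfield R n.+3,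
    [/\ vf_degree chi = d.+1, on_sphere chi
      & exists (k : nat) (a : 'I_k -> 'I_n.+2 -> R),
          (d <= k)%N /\ meridian_family chi a (fun=> n.+1)].
Proof.
move=> d1; have d0 := ltnW d1.
have := @inverse_jet_neq0 _ (even_roots_poly R d)^`() n.+1.
rewrite size_even_roots_poly_deriv // => /(_ d1).
case/(even_roots_poly_generic d0) => c [s [us ss Fs js]].
exists (@pencil_field R n s); split.
- rewrite -ss; apply: pencil_field_degree.
  by rewrite -size_eq0 ss -lt0n.
- exact: lift_field_on_sphere.
- exists (size s), (fun k : 'I_(size s) => @pencil_normal R n s`_k).
  split; first by rewrite ss.
  apply: pencil_field_family => // x xs.
  by rewrite -Fs derivB derivC subr0 js.
Qed.

(** * The upper bound on the two-sphere *)

Section ProductOfMeridians.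
Variables (R : realType) (n k : nat) (a : 'I_k -> 'I_n -> R) (mu : 'I_k -> nat).
Hypothesis ua : forall i, unit_normal (a i).
Hypothesis zI : injective (fun i => zero_set (meridian (a i))).

(** Distinct hyperplanes have non-associated prime forms. *)
Lemma meridian_prod_dvd (E : {mpoly R[n.+1]}) :
  (forall i, mpdivides (meridian (a i) ^+ mu i) E) ->
  mpdivides (\prod_i meridian (a i) ^+ mu i) E.
Proof.
move=> dE; suff dr r : uniq r -> mpdivides (\prod_(i <- r) meridian (a i) ^+ mu i) E.
  by apply: dr; apply: index_enum_uniq.
elim: r => [|i r IH] /=; first by exists E; rewrite big_nil mulr1.
case/andP=> ir /IH[q Eq].
have [q' qE] : mpdivides (meridian (a i) ^+ mu i) q.
  apply: (meridian_dvd_cancel (ua i) (g := \prod_(j <- r) meridian (a j) ^+ mu j)).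
    case/(meridian_dvd_prod (ua i)) => j jr /(meridian_dvdX (ua i)).
    by move/(meridian_dvd_eqset (ua i) (ua j))/zI => ji; rewrite ji (negPf ir) in jr.
  by rewrite -Eq.
by exists q'; rewrite big_cons mulrA -qE.
Qed.

Lemma msize_meridian_prod : msize (\prod_i meridian (a i) ^+ mu i) = (\sum_i mu i).+1.
Proof.
elim/big_rec2: _ => [|i t y _ IH]; first by rewrite msize1.
rewrite msizeM ?msize_meridianX ?IH ?addSn ?addnS //.
  by rewrite expf_neq0 ?meridian_neq0.
by rewrite -msize_poly_eq0 IH.
Qed.

End ProductOfMeridians.

(** The degree of the extactic polynomial bounds the exponents. *)
Lemma exists_multiplicity (R : realType) (n : nat) (chi : vfield R n.+1) a :
  unit_normal a -> extactic (@meridian_basis R n) chi != 0 ->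
  exists mu, has_multiplicity (@meridian_basis R n) chi (meridian a) mu.
Proof.
move=> ua E0; set E := extactic _ _ in E0.
pose P k := `[< mpdivides (meridian a ^+ k) E >].
have P0 : exists k, P k by exists 0%N; apply/asboolP; exists E; rewrite expr0 mulr1.
have Pb k : P k -> (k <= msize E)%N.
  move=> /asboolP[q Eq]; move: E0; rewrite Eq => qk0.
  have q0 : q != 0 by apply: contraNneq qk0 => ->; rewrite mul0r.
  rewrite msizeM ?expf_neq0 ?meridian_neq0 // msize_meridianX // addnS.
  exact: leq_addl.
case: (ex_maxnP P0 Pb) => mu /asboolP dmu max; exists mu; split=> //; first by exists a.
move=> mu' lt_mu dmu'; move: lt_mu; rewrite ltnNge => /negP; apply.
by apply: max; apply/asboolP.
Qed.

Section IsotropicLine.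
Variable (R : realType) (N : nat).
Implicit Types (h : 'I_N -> {poly R[i]}) (p : {mpoly R[N]}).

(** Restriction to a parametrised complex line, for h of degree at most 1. *)
Definition line_eval h p : {poly R[i]} := mmap (polyC \o real_complex R) h p.

Lemma line_evalD h : {morph line_eval h : p q / p + q}. Proof. exact: mmapD. Qed.
Lemma line_evalB h : {morph line_eval h : p q / p - q}. Proof. exact: mmapB. Qed.
Lemma line_evalM h : {morph line_eval h : p q / p * q}.
Proof. by move=> p q; rewrite /line_eval rmorphM. Qed.
Lemma line_eval0 h : line_eval h 0 = 0.
Proof. exact: mmap0. Qed.
Lemma line_eval1 h : line_eval h 1 = 1.
Proof. by rewrite /line_eval rmorph1. Qed.
Lemma line_evalX h i : line_eval h 'X_i = h i.
Proof. by rewrite /line_eval mmapX mmap1U. Qed.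
Lemma line_evalZ h c p : line_eval h (c *: p) = (real_complex R c) *: line_eval h p.
Proof. by rewrite /line_eval mmapZ mul_polyC. Qed.

Lemma size_line_eval h p : (forall i, size (h i) <= 2)%N ->
  (size (line_eval h p) <= msize p)%N.
Proof.
move=> h2; rewrite /line_eval /mmap.
apply: leq_trans (size_sum _ _ _) _; apply/bigmax_leqP_seq => m mp _.
rewrite /= mul_polyC (leq_trans (size_scale_leq _ _)) //.
apply: (@leq_trans (mdeg m).+1); last first.
  by rewrite ltnNge; apply: contraL mp; apply: msize_mdeg_ge.
rewrite mdegE /mmap1; elim/big_rec2: _ => [|i s y _ IH]; first by rewrite size_poly1.
apply: size_polyM_leq => //.
elim: (m i) => [|k IHk]; first by rewrite expr0 size_poly1.
by rewrite exprS; apply: (@size_polyM_leq _ _ _ 1 k).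
Qed.

End IsotropicLine.

Section UpperBound.
Variables (R : realType) (chi : vfield R 3).
Notation X := (@meridian_basis R 2).
Let m := vf_degree chi.
Let P (j : 'I_2) := chi (widen_ord (leqnSn 2) j).
Let E := extactic X chi.

Lemma msize_component i : (msize (chi i) <= m.+1)%N.
Proof.
have : ((msize (chi i)).-1 <= m)%N by apply: (leq_bigmax (F := fun i => (msize (chi i)).-1) i).
by case: (msize (chi i)).
Qed.

Lemma extactic_plane : E = X ord0 * P ord_max - X ord_max * P ord0.
Proof. by rewrite /E /extactic det2E !mxE /= !vf_opX. Qed.

Lemma msize_extactic_plane : (msize E <= m.+2)%N.
Proof.
rewrite extactic_plane; apply: leq_trans (msizeD_le _ _) _; rewrite mmeasureN geq_max.
by apply/andP; split; apply: (@msizeM_leq _ _ _ _ 1 m.+1 (eq_leq (msizeXU _ _)) (msize_component _)).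
Qed.

(** From x_1 P_2 = x_2 P_1 and the primality of x_1, the field is g times the
    Euler field in the variables x_1, x_2. *)
Lemma extactic0_invariant a : E = 0 -> Defs.invariant chi (meridian a).
Proof.
rewrite extactic_plane => /eqP; rewrite subr_eq0 => /eqP XP.
have u0 := @coord_normal_unit R 2 ord0.
have [||[g P0]] := @meridian_dvdM _ _ _ u0 (X ord_max) (P ord0).
- by exists (P ord_max); rewrite -XP meridian_coord mulrC.
- move=> dX; have := mpdivides_eval dX (p := punctured_point R ord0).
  rewrite meridian_coord !punctured_basis eqxx => /(_ erefl)/eqP.
  by rewrite -(inj_eq val_inj) /= oner_eq0.
rewrite meridian_coord in P0.
have P1 : P ord_max = g * X ord_max.
  have X0 : X ord0 != 0 by apply: mpolyXU_neq0.
  apply: (mulfI X0).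
  by rewrite [LHS]XP P0; ring.
exists g; rewrite vf_op_meridian /meridian mulr_sumr; apply: eq_bigr => j _.
rewrite -/(P j) -scalerAr; congr (_ *: _).
case: (unliftP ord0 j) => [i|] ->; last by rewrite P0.
by rewrite (_ : lift _ _ = ord_max) ?P1 //; apply/val_inj; rewrite /= ord1.
Qed.

(** The normals (- k, 1) / sqrt(1 + k^2), for k a natural number, give
    infinitely many meridian hyperplanes. *)
Lemma finite_extactic_neq0 : finite_set (invariant_meridians chi) -> E != 0.
Proof.
move=> fin; apply/eqP => E0; apply: infinite_nat.
pose F (k : nat) := zero_set (meridian (@pencil_normal R 0 k%:R)).
have -> : [set: nat] = F @^-1` (invariant_meridians chi).
  apply/seteqP; split=> // k _; exists (@pencil_normal R 0 k%:R); split=> //.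
    exact: pencil_normal_unit.
  exact: extactic0_invariant.
apply: finite_preimage fin => k l _ _ /zero_set_pencil_inj/eqP.
by rewrite eqr_nat => /eqP.
Qed.

Hypothesis chi_sphere : on_sphere chi.

Let isotropic (i : 'I_3) : {poly R[i]} := nth 0 [:: 'X; 'i%C *: 'X; 0] i.

Lemma size_isotropic i : (size (isotropic i) <= 2)%N.
Proof.
rewrite /isotropic; case: i => [[|[|[|i]]] //= _]; rewrite ?size_polyX ?size_poly0 //.
by rewrite (leq_trans (size_scale_leq _ _)) ?size_polyX.
Qed.

(** On the isotropic line x_1^2 + x_2^2 - 1 restricts to -1, so K restricts to
    minus chi of the sphere polynomial, that is -2 t (P_1 + i P_2), while E
    restricts to t (P_2 - i P_1). *)
Lemma size_isotropic_extactic : (size (line_eval isotropic E) <= m)%N.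
Proof.
have [K KS] := chi_sphere.
have oE : widen_ord (leqnSn 2) ord_max = lift ord0 ord0 :> 'I_3 by apply/val_inj.
have o0 : widen_ord (leqnSn 2) ord0 = ord0 :> 'I_3 by apply/val_inj.
have mE : lift ord0 (lift ord0 ord0) = ord_max :> 'I_3 by apply/val_inj.
have szK : (msize K <= m)%N.
  case: (eqVneq K 0) => [->|K0]; first by rewrite msize0.
  (* the degree of the sphere polynomial is seen on the first axis *)
  have S3 : (2 < msize (sphere_poly R 2))%N.
    pose h (i : 'I_3) : {poly R[i]} := if i == ord0 then 'X else 0.
    apply: leq_trans (size_line_eval (h := h) _ _) => [|i]; last first.
      by rewrite /h; case: eqP; rewrite ?size_polyX ?size_poly0.
    rewrite /sphere_poly !big_ord_recl big_ord0 line_evalB line_eval1 !line_evalD.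
    rewrite !expr2 !line_evalM !line_evalX /h /= !mul0r.
    rewrite line_eval0 !addr0 -expr2.
    by rewrite size_polyDl ?size_polyXn // size_polyN size_poly1.
  have : (msize (vf_op chi (sphere_poly R 2)) <= m.+2)%N.
    rewrite vf_op_sphere; apply: leq_trans (msize_sum _ _ _) _; apply/bigmax_leqP => i _.
    rewrite -scaler_nat; apply: leq_trans (msizeZ_le _ _) _; rewrite mulrC.
    exact: (@msizeM_leq _ _ _ _ 1 m.+1 (eq_leq (msizeXU _ _)) (msize_component _)).
  have S0 : sphere_poly R 2 != 0 by rewrite -msize_poly_eq0 -lt0n ltnW // ltnW.
  rewrite KS msizeM //; move: S3; case: (msize (sphere_poly R 2)) => [|[|[|t]]] // _.
  by rewrite !addnS /= !ltnS; apply: leq_trans; apply: leq_addr.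
have ii : 'i%C * 'i%C = -1 :> R[i] by rewrite -expr2 sqr_i.
have II : 'i%C%:P * 'i%C%:P = -1 :> {poly R[i]} by rewrite -polyCM ii polyCN.
have eS : line_eval isotropic (sphere_poly R 2) = -1.
  rewrite /sphere_poly !big_ord_recl big_ord0 line_evalB line_eval1 !line_evalD line_eval0.
  rewrite !expr2 !line_evalM !line_evalX mE /isotropic /= -!mul_polyC.
  have -> : 'i%C%:P * 'X * ('i%C%:P * 'X) = ('i%C%:P * 'i%C%:P) * ('X * 'X) :> {poly R[i]} by ring.
  by rewrite II; ring.
have eV : line_eval isotropic (vf_op chi (sphere_poly R 2)) =
    (line_eval isotropic (P ord0) * 'X + line_eval isotropic (P ord_max) * ('i%C%:P * 'X)) *+ 2.
  rewrite vf_op_sphere !big_ord_recl big_ord0 !line_evalD line_eval0 !line_evalM !line_evalX.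
  by rewrite mE /P oE o0 /isotropic /= -mul_polyC; ring.
have eE : line_eval isotropic E =
    'X * line_eval isotropic (P ord_max) - 'i%C%:P * 'X * line_eval isotropic (P ord0).
  rewrite extactic_plane line_evalB !line_evalM /meridian_basis !line_evalX oE o0 /isotropic /=.
  by rewrite -mul_polyC.
have KE : 'i%C *: line_eval isotropic K = 2%:R *: line_eval isotropic E.
  have eK : line_eval isotropic K = - (line_eval isotropic (vf_op chi (sphere_poly R 2))).
    by rewrite KS line_evalM eS mulrN1 opprK.
  rewrite eK eV eE -!mul_polyC polyC_natr.
  set I := 'i%C%:P in II *.
  transitivity (2%:R * ('X * (- (I * I) * line_eval isotropic (P ord_max)) - I * 'X * line_eval isotropic (P ord0)));
    first by ring.
  by rewrite II opprK mul1r.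
have -> : line_eval isotropic E = (2%:R^-1 * 'i%C) *: line_eval isotropic K.
  by rewrite -scalerA KE scalerA mulVf ?scale1r // pnatr_eq0.
apply: leq_trans (size_scale_leq _ _) _; apply: leq_trans szK.
exact: size_line_eval size_isotropic.
Qed.

(** A real linear form a_0 x_1 + a_1 x_2 takes the value (a_0 + i a_1) t, and
    a_0 + i a_1 is not zero. *)
Lemma size_isotropic_meridian a : unit_normal a -> size (line_eval isotropic (meridian a)) = 2%N.
Proof.
move=> ua; pose c : R[i] := Complex (a ord0) (a ord_max).
have -> : line_eval isotropic (meridian a) = c *: 'X.
  have l1 : lift ord0 ord0 = ord_max :> 'I_2 by apply/val_inj.
  rewrite /meridian big_ord_recl big_ord1 line_evalD !line_evalZ !line_evalX l1 /isotropic /=.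
  rewrite scalerA -scalerDl; congr (_ *: _).
  by apply/eqP; rewrite eq_complex /=; apply/andP; split; apply/eqP; ring.
rewrite size_scale ?size_polyX //; apply/eqP => -[a0 a1].
move: ua; rewrite /unit_normal big_ord_recl big_ord1 a0.
rewrite (_ : lift _ _ = ord_max); last by apply/val_inj.
by rewrite a1 expr0n addr0 => /esym/eqP; rewrite oner_eq0.
Qed.

Lemma sum_multiplicity_plane k (a : 'I_k -> 'I_2 -> R) (mu : 'I_k -> nat) :
  meridian_family chi a mu -> E != 0 -> (\sum_i mu i <= m)%N.
Proof.
move=> [zI fam] E0; rewrite leqNgt; apply/negP => lt_m.
have ua i : unit_normal (a i) by have [] := fam i.
have [q Eq] : mpdivides (\prod_i meridian (a i) ^+ mu i) E.
  by apply: meridian_prod_dvd => // i; have [_ _ []] := fam i.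
have q0 : q != 0 by apply: contraNneq E0; rewrite Eq => ->; rewrite mul0r.
have D0 : \prod_i meridian (a i) ^+ mu i != 0.
  by rewrite -msize_poly_eq0 msize_meridian_prod.
have := msize_extactic_plane; rewrite {1}Eq msizeM // msize_meridian_prod // addnS /=.
have q1 : (0 < msize q)%N by rewrite lt0n msize_poly_eq0.
move=> szq.
have /msize1_polyC qC : (msize q <= 1)%N.
  by rewrite -(leq_add2r (\sum_i mu i)); apply: leq_trans szq _.
have c0 : q@_0%MM != 0 by apply: contraNneq q0 => c0; rewrite qC c0 mpolyC0.
have := size_isotropic_extactic; rewrite Eq qC mul_mpolyC line_evalZ size_scale ?fmorph_eq0 //.
suff -> : size (line_eval isotropic (\prod_i meridian (a i) ^+ mu i)) = (\sum_i mu i).+1.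
  by apply/negP; rewrite -ltnNge ltnW.
elim/big_rec2: _ => [|i t y _ IH]; first by rewrite line_eval1 size_poly1.
have szX l : size (line_eval isotropic (meridian (a i) ^+ l)) = l.+1.
  elim: l => [|l IHl]; first by rewrite expr0 line_eval1 size_poly1.
  rewrite exprS line_evalM size_mul -?size_poly_eq0 ?IHl ?size_isotropic_meridian //.
by rewrite line_evalM size_mul -?size_poly_eq0 ?szX ?IH // addSn addnS.
Qed.

Lemma num_meridians_le : finite_set (invariant_meridians chi) ->
  exists d, num_meridians chi d /\ (d <= m)%N.
Proof.
move=> fin; have E0 := finite_extactic_neq0 fin.
have [sq sqE] := (finite_seqP _).1 fin.
pose r := undup sq.
have rE H : H \in r <-> invariant_meridians chi H.
  by rewrite mem_undup sqE /=.
have [a aP] : exists a : 'I_(size r) -> 'I_2 -> R, forall i,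
    [/\ unit_normal (a i), Defs.invariant chi (meridian (a i))
      & nth set0 r i = zero_set (meridian (a i))].
  have ex (i : 'I_(size r)) : exists b, [/\ unit_normal b, Defs.invariant chi (meridian b)
      & nth set0 r i = zero_set (meridian b)].
    by apply/rE/mem_nth.
  by have [a aP] := boolp.choice ex; exists a.
have [mu muP] : exists mu : 'I_(size r) -> nat, forall i,
    has_multiplicity X chi (meridian (a i)) (mu i).
  have ex (i : 'I_(size r)) : exists mu, has_multiplicity X chi (meridian (a i)) mu.
    by apply: exists_multiplicity => //; have [] := aP i.
  by have [mu muP] := boolp.choice ex; exists mu.
have fam : meridian_family chi a mu.
  split=> [i j ij|i]; last by have [ui ii _] := aP i; split=> //.
  have [_ _ ri] := aP i; have [_ _ rj] := aP j.
  have := ij; rewrite -ri -rj => /eqP; rewrite nth_uniq ?undup_uniq // => /eqP.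
  exact: val_inj.
exists (\sum_i mu i)%N; split; last exact: (sum_multiplicity_plane fam E0).
exists (size r), a, mu; split=> //.
apply/seteqP; split=> [H /rE Hr|_ [i _ <-]].
  have ir : (index H r < size r)%N by rewrite index_mem.
  exists (Ordinal ir) => //; have [_ _ <-] := aP (Ordinal ir).
  by rewrite /= nth_index.
by have [ui ii _] := aP i; exists (a i); split.
Qed.

End UpperBound.

(** * The theorem *)

Theorem theorem1p3 (R : realType) (m n : nat) (hm : (1 < m)%N) (hn : (1 < n)%N) :
  [/\ (* (1) *)
      (exists chi : vfield R n.+1,
         [/\ vf_degree chi = m, on_sphere chi
           & at_least_meridians chi
               ('C(n - 1, 2) * (m - 2) + (n - 1) * (m - 1))%N]),
      (* (2) *)
      (exists chi : vfield R n.+1,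
         [/\ vf_degree chi = m, on_sphere chi
           & exists (k : nat) (a : 'I_k -> 'I_n -> R),
               (m - 1 <= k)%N /\
               meridian_family chi a (fun _ : 'I_k => (n - 1)%N)]),
      (* (3) *)
      (forall chi : vfield R 3,
         vf_degree chi = m -> on_sphere chi ->
         finite_set (invariant_meridians chi) ->
         exists d : nat, num_meridians chi d /\ (d <= m)%N) /\
      (exists chi : vfield R 3,
         [/\ vf_degree chi = m, on_sphere chi,
             finite_set (invariant_meridians chi)
           & num_meridians chi m])
    & (* (4) *)
      (exists chi : vfield R 4,
         [/\ vf_degree chi = m, on_sphere chi
           & num_meridians chi (3 * m - 2)%N])].
Proof.
case: n hn => [|[|n']] // _; split.
- exists (@diag_field R m n'); split.
  + exact: diag_field_degree.
  + exact: lift_field_on_sphere.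
  + have [k [a [mu [fam _ tot]]]] := @diag_field_num_meridians R m n' hm.
    exists k, a, mu; split=> //; rewrite -tot.
    have -> : 'C(n'.+2, 2) = ('C(n'.+2 - 1, 2) + (n'.+2 - 1))%N.
      by rewrite subn1 binS bin1.
    by nia.
- case: (ltnP 2 m) => [m_gt2|m_le2].
    have [|chi [degchi sph [k [a [dk fam]]]]] := @exists_pencil_field R n' (m - 1).
      by lia.
    exists chi; split=> //; first by rewrite degchi; lia.
    by exists k, a; split=> //; rewrite subn1.
  have {m_le2} m2 : m = 2%N by lia.
  exists (@chain_field R n'); split; first by rewrite m2 chain_field_degree.
    exact: lift_field_on_sphere.
  exists 1%N, (fun=> coord_normal R ord0); rewrite m2; split=> //.
  by rewrite subn1; apply: chain_field_meridian_family.
- split=> [chi <- sph fin|]; first exact: num_meridians_le.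
  have num : num_meridians (@diag_field R m 0) m.
    have := @diag_field_num_meridians R m 0 hm.
    by rewrite (_ : 2 + _ = m)%N // (_ : 'C(2, 2) = 1%N) //; lia.
  exists (@diag_field R m 0); split=> //.
  + exact: diag_field_degree.
  + exact: lift_field_on_sphere.
  + have [k [a [mu [_ -> _]]]] := num.
    by apply: finite_image; apply: finite_finset.
- exists (@rotation_field R m); split.
  + exact: rotation_field_degree.
  + exact: rotation_field_on_sphere.
  + exact: rotation_field_num_meridians.
Qed.
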